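(* Let $\ell\ge1$. The map $\psi:\Sigma\to\mathcal{G}_{tight}$ is continuous, and $\psi$ factors through the equivalence relation $\sim$ on $\Sigma$. The induced map $\tilde\psi:\mathcal{G}=\Sigma/\!\sim\ \to\mathcal{G}_{tight}$ is an isomorphism of topological groupoids.
   Context: $\mathbb{N}$ is the set of non-negative integers, $\ell$ a positive integer, $\overline{\mathbb{N}}=\mathbb{N}\cup\{\infty\}$ (one point compactification), $\overline{\mathbb{Z}}=\mathbb{Z}\cup\{\infty\}$ (with $+\infty$ added). For an $\ell$-tuple $k\in\overline{\mathbb N}^\ell$ we set $k_{\ell+1}=\infty$; $\pi_r$ denotes projection onto the first $r$ components. **The inverse semigroup $T$.** $S$ is the left shift on $\ell^2(\mathbb{N})$ ($Se_n=e_{n-1}$, $Se_0=0$), $t$ is the right shift on $\ell^2(\mathbb{Z})$ ($te_n=e_{n+1}$), $p=|e_0\rangle\langle e_0|$. On $\ell^2(\mathbb{N})^{\otimes\ell}\otimes\ell^2(\mathbb{Z})$, for $r\in\mathbb{Z}$, $m,n\in\mathbb{N}^\ell$ and $1\le k\le\ell$, let $$B_k(r,m,n)=S^{*m_1}pS^{n_1}\otimes\cdots\otimes S^{*m_{k-1}}pS^{n_{k-1}}\otimes S^{*m_k}S^{n_k}\otimes1\otimes t^{\sum_{i=1}^k(m_i-n_i)}$$ ($1$ being the identity on the remaining $\ell-k$ copies of $\ell^2(\mathbb N)$; no dependence on $r$), and $$B_{\ell+1}(r,m,n)=S^{*m_1}pS^{n_1}\otimes\cdots\otimes S^{*m_\ell}pS^{n_\ell}\otimes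 t^{r+\sum_{i=1}^\ell(m_i-n_i)}.$$ $T=\{0\}\cup\{B_i(r,m,n):1\le i\le\ell+1,\ r\in\mathbb{Z},\ m,n\in\mathbb{N}^\ell\}$ is an inverse semigroup of partial isometries with $0$, with involution the adjoint. Its set of projections is $E=\{0\}\cup\{p_i(m):1\le i\le\ell+1,\ m\in\mathbb{N}^\ell\}$, where $p_i(m)=B_i(0,m,m)$. **Characters.** $\hat E_0$ is the set of nonzero multiplicative maps $x:E\to\{0,1\}$ with $x(0)=0$, with the topology inherited from the product space $\{0,1\}^E$. A filter in $E$ is a nonempty subset $A$ with $0\notin A$, closed under products and upward closed; characters $x$ correspond bijectively to filters $A_x=\{e\in E:x(e)=1\}$. $\hat E_\infty$ is the set of $x$ with $A_x$ a maximal filter (ultrafilter), and $\hat E_{tight}$ is the closure of $\hat E_\infty$ in $\hat E_0$. **The groupoid $\mathcal{G}_{tight}$.** $T$ acts on the right on $\hat E_0$: for $s\in T$, let $D_s=\{x\in\hat E_0:x(ss^* )=1\}$, and for $x\in D_s$ let $(x.s)(e)=x(ses^* )$. On $\{(x,s):s\in T,\ x\in D_s\}$ put $(x,s)(y,t)=(x,st)$ if $y=x.s$, and $(x,s)^{-1}=(x.s,s^* )$. Identify $(x,s)$ with $(y,t)$ if $x=y$ and there is $e\in E$ with $x(e)=1$ and $es=et$; write $[x,s]$ for the class. The quotient is a topological groupoid $\mathcal{G}(T)$, with basis of topology the sets $\theta(s,V)=\{[x,s]:x\in V\}$, $s\in T$, $V\subseteq D_s$ open; its unit space is identified with $\hat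 E_0$. $\mathcal{G}_{tight}$ is the reduction of $\mathcal{G}(T)$ to the invariant closed subset $\hat E_{tight}$. **The map $\phi$.** For $k\in\overline{\mathbb N}^\ell$ let $r$ be the least nonnegative integer with $k_{r+1}=\infty$, and let $\phi(k)\in\hat E_0$ be the character whose filter is $\{f\in E: f\ge p_{r+1}(\pi_r(k),n)\text{ for some }n\in\mathbb{N}^{\ell-r}\}$. It takes values in $\hat E_{tight}$. **Sheu's groupoid $\mathcal{G}$.** Let $\mathbb{Z}^\ell$ act on $\overline{\mathbb Z}^\ell$ by translation and consider the groupoid $\mathbb{Z}\times(\mathbb{Z}^\ell\times\overline{\mathbb Z}^\ell)$, the product of the group $\mathbb{Z}$ with the transformation groupoid: $(z,x,w)$ has range $w$ and source $w+x$, with $(z,x,w)(z',x',w+x)=(z+z',x+x',w)$. Let $\mathcal{F}$ be its restriction to $\overline{\mathbb N}^\ell$ (elements with $w,\,w+x\in\overline{\mathbb N}^\ell$). Let $$\Sigma=\Big\{(z,x,w)\in\mathcal{F}: w_i=\infty\Rightarrow x_{i+1}=\cdots=x_\ell=0\text{ and }z=-\sum_{j=1}^i x_j\Big\},$$ an open subgroupoid of $\mathcal{F}$. Let $\sim$ be the equivalence relation on $\Sigma$ generated by $(z,x,w_1,\dots,w_{i-1},\infty,w_{i+1},\dots,w_\ell)\sim(z,x,w_1,\dots,w_{i-1},\infty,\infty,\dots,\infty)$. Then $\mathcal{G}=\Sigma/\!\sim$, with the induced operations and the quotient topology, is a topological groupoid. **The map $\psi$.** For $(z,x,w)\in\Sigma$,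 let $r$ be the least nonnegative integer with $w_{r+1}=\infty$, and set $$\psi(z,x,w)=[\phi(w),B_{r+1}(a,m,n)],\qquad a=z+\sum_{j=1}^r x_j,$$ $$m=(w_1,\dots,w_r,|x_{r+1}|,0,\dots,0),\quad n=(x_1+w_1,\dots,x_r+w_r,\,x_{r+1}+|x_{r+1}|,0,\dots,0)$$ (when $r=\ell$, $m=(w_1,\dots,w_\ell)$ and $n=(x_1+w_1,\dots,x_\ell+w_\ell)$). *)

(* Defs.v *)
From HB Require Import structures.
From Stdlib Require Import Relation_Operators.
From mathcomp Require Import all_boot all_order all_algebra.
From mathcomp Require Import complex zify ring lra.
From mathcomp Require Import all_classical all_reals topology ereal sequences esum numfun.

Set Implicit Arguments.
Unset Strict Implicit.
Unset Printing Implicit Defensive.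

Import Order.TTheory GRing.Theory Num.Theory.

Local Open Scope classical_set_scope.
Local Open Scope ring_scope.
Local Open Scope quotient_scope.

Record invSemigroup0 := InvSemigroup0 {
  isg_sort :> choiceType;
  smul : isg_sort -> isg_sort -> isg_sort;
  star : isg_sort -> isg_sort;
  szero : isg_sort;
  smulA : associative smul;
  smul_star_smul : forall s, smul (smul s (star s)) s = s;
  star_smul_star : forall s, smul (smul (star s) s) (star s) = star s;
  star_unique : forall s t,
    smul (smul s t) s = s -> smul (smul t s) t = t -> t = star s;
  smul0s : left_zero szero smul;
  smuls0 : right_zero szero smul }.

Arguments szero {_}.
Local Notation "s ** t" := (smul s t) (at level 40, left associativity).

Section InverseSemigroup.
Variable T : invSemigroup0.
Implicit Types s t : T.

Definition is_proj (e : T) := e ** e = e /\ star e = e.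

Lemma sstarK s : star (star s) = s.
Proof. by apply/esym/star_unique; [exact: star_smul_star|exact: smul_star_smul]. Qed.

Lemma star_idem (e : T) : e ** e = e -> star e = e.
Proof. by move=> ee; apply/esym/star_unique; rewrite !ee. Qed.

Lemma idemM (e f : T) : e ** e = e -> f ** f = f -> (e ** f) ** (e ** f) = e ** f.
Proof.
move=> ee ff; set x := star (e ** f).
have efx : e ** f ** x ** (e ** f) = e ** f by exact: smul_star_smul.
have xef : x ** (e ** f) ** x = x by exact: star_smul_star.
have yx : f ** x ** e = x.
  apply: star_unique.
    by rewrite -!smulA (smulA e e) ee (smulA f f) ff !smulA -[RHS]efx !smulA.
  transitivity (f ** (x ** (e ** f) ** x) ** e); last by rewrite xef.
  by rewrite -!smulA (smulA e e) ee (smulA f f) ff.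
have xx : x ** x = x.
    transitivity (f ** (x ** (e ** f) ** x) ** e); last by rewrite xef.
  by rewrite -{1 2}yx -!smulA.
by have := star_idem xx; rewrite /x sstarK => ->; exact: xx.
Qed.

Lemma idemC (e f : T) : e ** e = e -> f ** f = f -> e ** f = f ** e.
Proof.
move=> ee ff; have eef := idemM ee ff; have ffe := idemM ff ee.
rewrite -(star_idem eef); apply/esym/star_unique.
  by rewrite -!smulA (smulA f f) ff (smulA e e) ee smulA eef.
by rewrite -!smulA (smulA e e) ee (smulA f f) ff smulA ffe.
Qed.

Lemma sstar_idem s : (s ** star s) ** (s ** star s) = s ** star s.
Proof. by rewrite smulA smul_star_smul. Qed.

Lemma star_s_idem s : (star s ** s) ** (star s ** s) = star s ** s.
Proof. by rewrite smulA star_smul_star. Qed.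

Lemma starM s t : star (s ** t) = star t ** star s.
Proof.
have C := idemC (sstar_idem t) (star_s_idem s).
apply/esym/star_unique.
  rewrite -[RHS](congr2 (@smul T) (smul_star_smul s) (smul_star_smul t)).
  rewrite -!smulA; congr (s ** _); move: C; rewrite -!smulA => C.
  by have := congr1 (fun z => z ** t) C; rewrite -!smulA.
rewrite -[RHS](congr2 (@smul T) (star_smul_star t) (star_smul_star s)).
rewrite -!smulA; congr (star t ** _); move: C; rewrite -!smulA => C.
by have := congr1 (fun z => z ** star s) C; rewrite -!smulA => ->.
Qed.

Lemma proj_mul (e f : T) : is_proj e -> is_proj f -> is_proj (e ** f).
Proof.
by move=> [ee _] [ff _]; split; [exact: idemM|apply: star_idem; exact: idemM].
Qed.

Lemma proj_conj s (e : T) : is_proj e -> is_proj (s ** e ** star s).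
Proof.
move=> [ee _]; suff H : (s ** e ** star s) ** (s ** e ** star s) = s ** e ** star s.
  by split=> //; exact: star_idem.
have C := idemC ee (star_s_idem s).
transitivity (s ** (e ** (star s ** s)) ** e ** star s); first by rewrite !smulA.
by rewrite C !smulA smul_star_smul -(smulA s e e) ee.
Qed.

Lemma proj_zero : is_proj (szero : T).
Proof. by split; [exact: smul0s|apply: star_idem; exact: smul0s]. Qed.

Lemma proj_range s : is_proj (s ** star s).
Proof. by split; [|apply: star_idem]; exact: sstar_idem. Qed.

Lemma proj_source s : is_proj (star s ** s).
Proof. by split; [|apply: star_idem]; exact: star_s_idem. Qed.

Definition projs : set T := [set e | is_proj e].
Definition proj_of (e : T) (h : is_proj e) : projs := exist _ e (mem_set h).

Lemma projP (e : projs) : is_proj (val e).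
Proof. by have /set_mem := valP e. Qed.

Definition pmul (e f : projs) : projs := proj_of (proj_mul (projP e) (projP f)).
Definition pzero : projs := proj_of proj_zero.
Definition prange s : projs := proj_of (proj_range s).
Definition pconj s (e : projs) : projs := proj_of (proj_conj s (projP e)).

Definition proj_le (e f : projs) : Prop := pmul e f = e.

Definition is_filter (A : set projs) : Prop :=
  [/\ A !=set0, ~ A pzero, (forall e f : projs, A e -> A f -> A (pmul e f))
    & (forall e f : projs, A e -> proj_le e f -> A f)].

Definition is_ultrafilter (A : set projs) : Prop :=
  is_filter A /\ forall B, is_filter B -> A `<=` B -> B `<=` A.

Definition is_char (x : {ptws projs -> bool}) : Prop :=
  [/\ (exists e : projs, x e), (forall e f : projs, x (pmul e f) = x e && x f) & x pzero = false].

Definition chars : set {ptws projs -> bool} := [set x | is_char x].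

Definition char_filter (x : chars) : set projs := [set e | val x e].

Definition chars_infty : set chars := [set x : chars | is_ultrafilter (char_filter x)].
Definition chars_tight : set chars := closure chars_infty.

Definition char_dom s : set chars := [set x : chars | val x (prange s)].

Definition act_pairs : set (chars * T) := [set p : chars * T | char_dom p.2 p.1].

Lemma charP (x : chars) : is_char (val x).
Proof. by have /set_mem := valP x. Qed.

Lemma char_mul (x : chars) (e f : projs) : val x (pmul e f) = val x e && val x f.
Proof. by have [] := charP x. Qed.

Lemma char_filterP (x : chars) : is_filter (char_filter x).
Proof.
have [[e xe] xM x0] := charP x; split.
- by exists e.
- by rewrite /char_filter/= x0.
- by move=> a b xa xb; rewrite /char_filter/= xM xa xb.
- by move=> a b xa ab; move: xa; rewrite /char_filter/= -ab xM => /andP[].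
Qed.

Lemma pmulC e f : pmul e f = pmul f e.
Proof. by apply/val_inj/idemC; [have [] := projP e|have [] := projP f]. Qed.

Lemma pmulA e f g : pmul e (pmul f g) = pmul (pmul e f) g.
Proof. by apply/val_inj; exact: smulA. Qed.

Lemma pmulee e : pmul e e = e.
Proof. by apply/val_inj; have [] := projP e. Qed.

Lemma pconjM s e f : pconj s (pmul e f) = pmul (pconj s e) (pconj s f).
Proof.
apply/val_inj => /=; apply/esym.
have C := idemC (projP e).1 (star_s_idem s).
transitivity (s ** (val e ** (star s ** s)) ** val f ** star s);
  first by rewrite !smulA.
by rewrite C !smulA smul_star_smul.
Qed.

Lemma pconj_source s : pconj s (proj_of (proj_source s)) = prange s.
Proof. by apply/val_inj; rewrite /= !smulA smul_star_smul. Qed.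

Lemma pconj0 s : pconj s pzero = pzero.
Proof. by apply/val_inj; rewrite /= smuls0 smul0s. Qed.

Lemma pconjV s e : pconj s (pconj (star s) e) = pmul e (prange s).
Proof.
apply/val_inj => /=; rewrite sstarK.
have C := idemC (projP e).1 (sstar_idem s).
transitivity ((s ** star s) ** val e ** (s ** star s)); first by rewrite !smulA.
by rewrite -C -smulA sstar_idem.
Qed.

Lemma act_pairP (p : act_pairs) : val (val p).1 (prange (val p).2).
Proof. by have /set_mem := valP p. Qed.

Lemma act_is_char (p : act_pairs) :
  is_char (fun e => val (val p).1 (pconj (val p).2 e)).
Proof.
split.
- by exists (proj_of (proj_source (val p).2)); rewrite pconj_source act_pairP.
- by move=> e f; rewrite -char_mul pconjM.
- by rewrite pconj0; have [] := charP (val p).1.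
Qed.

(** [act p] is [x.s] for [p = (x, s)] *)
Definition act (p : act_pairs) : chars :=
  exist _ ((fun e => val (val p).1 (pconj (val p).2 e)) : {ptws projs -> bool})
    (mem_set (act_is_char p)).

Lemma chars_infty_act (p : act_pairs) :
  chars_infty (val p).1 -> chars_infty (act p).
Proof.
move=> [_ xmax]; split; first exact: char_filterP.
set s := (val p).2; set x := (val p).1.
move=> B [[b Bb] B0 BM BU] AB e Be.
pose B' : set projs := fun f => exists e, B e /\ proj_le (pconj s e) f.
have Bs : B (proj_of (proj_source s)).
  by apply: AB; rewrite /char_filter/= pconj_source act_pairP.
apply: (xmax B') => /=.
- split.
  + by exists (pconj s b), b; split=> //; exact: pmulee.
  + move=> [f [Bf]]; rewrite /proj_le pmulC => h; apply: B0.
    suff -> : pzero = pmul f (proj_of (proj_source s)) by exact: BM.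
    have h0 : pconj s f = pzero.
      by rewrite -h; apply/val_inj; rewrite /= smul0s.
    have := congr1 (pconj (star s)) h0; rewrite pconj0 => <-.
    have := pconjV (star s) f; rewrite sstarK => ->.
    by congr (pmul _ _); apply/val_inj; rewrite /= sstarK.
  + move=> f g [f' [Bf' lf]] [g' [Bg' lg]]; exists (pmul f' g').
    split; first exact: BM.
    rewrite /proj_le pconjM -pmulA (pmulA _ f) (pmulC _ f) -(pmulA f).
    by rewrite pmulA lg; congr (pmul _ _).
  + move=> f g [f' [Bf' lf]] fg; exists f'; split => //.
    by rewrite /proj_le -lf -pmulA fg.
- move=> f xf; exists (pconj (star s) f); split.
    apply: AB; rewrite /char_filter/= pconjV char_mul.
    by rewrite act_pairP andbT; exact: xf.
  by rewrite pconjV /proj_le -pmulA (pmulC _ f) pmulA pmulee.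
- by exists e; split=> //; exact: pmulee.
Qed.

Definition germ_eq (p q : act_pairs) : Prop :=
  (val p).1 = (val q).1 /\
  exists e : projs, val (val p).1 e /\ val e ** (val p).2 = val e ** (val q).2.

Definition germ_eqb (p q : act_pairs) : bool := `[< germ_eq p q >].

Lemma germ_eqb_refl : reflexive germ_eqb.
Proof.
move=> p; apply/asboolP; split=> //; have [[e xe] _ _] := charP (val p).1.
by exists e.
Qed.

Lemma germ_eqb_sym : symmetric germ_eqb.
Proof.
suff H p q : germ_eqb p q -> germ_eqb q p.
  by move=> p q; apply/idP/idP; exact: H.
move=> /asboolP[pq [e [pe eq]]]; apply/asboolP; split=> //.
by exists e; rewrite -pq.
Qed.

Lemma germ_eqb_trans : transitive germ_eqb.
Proof.
move=> q p r /asboolP[pq [e [pe es]]] /asboolP[qr [f [qf ft]]].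
apply/asboolP; split; first by rewrite pq.
exists (pmul e f); rewrite char_mul pe {1}pq qf; split=> //=.
have C := idemC (projP e).1 (projP f).1.
by rewrite {1}C -smulA es smulA -C -!smulA ft.
Qed.

Definition germ_rel : equiv_rel act_pairs :=
  EquivRel germ_eqb germ_eqb_refl germ_eqb_sym germ_eqb_trans.

Definition germ : Type := {eq_quot germ_rel}.
HB.instance Definition _ := Quotient.on germ.
HB.instance Definition _ := Choice.on germ.

Lemma germ_eqP (p q : act_pairs) :
  reflect (germ_eq p q) (\pi_germ p == \pi_germ q).
Proof.
apply: (iffP eqP) => [h|h].
  by move/eqmodP : h => /asboolP.
by apply/eqmodP/asboolP.
Qed.

(** [theta s V] is $\theta(s,V)$ for $V\subseteq D_s$ *)
Definition theta s (V : set chars) : set germ :=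
  [set g | exists p : act_pairs, [/\ g = \pi p, (val p).2 = s & V (val p).1]].

(** The open sets of the topology with basis the sets [theta s V] *)
Definition germ_open (U : set germ) : Prop :=
  forall g, U g -> exists s (V : set chars),
    [/\ open V, V `<=` char_dom s, theta s V g & theta s V `<=` U].

Lemma open_char (e : projs) : open [set x : chars | val x e].
Proof.
exists (proj e @^-1` [set true]); last by apply/seteqP; split.
by apply: open_comp; [move=> x _; exact: proj_continuous|exact: discrete_open].
Qed.

Definition act_pair x s (h : char_dom s x) : act_pairs :=
  exist _ (x, s) (mem_set h).

Lemma germ_openT : germ_open setT.
Proof.
move=> g _; exists (val (repr g)).2, (char_dom (val (repr g)).2).
split=> //; first exact: open_char.
by exists (repr g); rewrite reprK; split=> //; exact: act_pairP.
Qed.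

Lemma germ_openI : setI_closed germ_open.
Proof.
move=> U1 U2 o1 o2 g [/o1[s [V [oV Vs gV VU]]] /o2[t [W [oW Wt gW WU]]]].
have [p [gp ps Vp]] := gV; have [q [gq qt Wq]] := gW.
have /eqP/germ_eqP[pq [e [xe eE]]] : \pi_germ p = \pi_germ q by rewrite -gp -gq.
rewrite ps qt in eE.
have domes (y : chars) : val y e -> char_dom s y -> char_dom (val e ** s) y.
  rewrite /char_dom/= => ye ys.
  suff -> : prange (val e ** s) = pmul e (prange s) by rewrite char_mul; apply/andP.
  apply/val_inj => /=; rewrite starM (projP e).2.
  have C := idemC (projP e).1 (sstar_idem s).
  transitivity (val e ** ((s ** star s) ** val e)); first by rewrite !smulA.
  by rewrite -C !smulA (projP e).1.
exists (val e ** s), (V `&` W `&` [set x : chars | val x e]); split.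
- by apply: openI; [exact: openI|exact: open_char].
- by move=> y [[/Vs ys _] ye]; exact: domes.
- exists (act_pair (domes _ xe (Vs _ Vp))); split=> //; last first.
    by split=> //; split=> //=; rewrite pq.
  rewrite gp; apply/eqP/germ_eqP; split=> //=; exists e; split=> //=.
  by rewrite ps smulA (projP e).1.
- move=> _ [r [-> rs [[Vr Wr] re]]]; split.
    apply: VU; exists (act_pair (Vs _ Vr)); split=> //.
    apply/eqP/germ_eqP; split=> //=; exists e; split=> //=.
    by rewrite rs smulA (projP e).1.
  apply: WU; exists (act_pair (Wt _ Wr)); split=> //.
  apply/eqP/germ_eqP; split=> //=; exists e; split=> //=.
  by rewrite rs smulA (projP e).1.
Qed.

Lemma germ_open_bigU (I : Type) (f : I -> set germ) :
  (forall i, germ_open (f i)) -> germ_open (\bigcup_i f i).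
Proof.
move=> fo g [i _ fg]; have [s [V [oV Vs gV VU]]] := fo i g fg.
by exists s, V; split=> // h /VU ?; exists i.
Qed.

HB.instance Definition _ :=
  isOpenTopological.Build germ germ_openT germ_openI germ_open_bigU.

Definition germ_mul (g h k : germ) : Prop :=
  exists p q u : act_pairs,
    [/\ g = \pi p, h = \pi q & k = \pi u] /\
    [/\ (val q).1 = act p, (val u).1 = (val p).1
      & (val u).2 = (val p).2 ** (val q).2].

Definition germ_inv (g h : germ) : Prop :=
  exists p q : act_pairs, [/\ g = \pi p, h = \pi q, (val q).1 = act p
    & (val q).2 = star (val p).2].

(** Both the range $x$ and the source $x.s$ of $[x,s]$ are tight; the unit [x] is
    identified with the germs $[x,e]$ such that $e\in E$, $x(e)=1$. *)
Definition Gtight : set germ :=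
  [set g | exists p : act_pairs,
    [/\ g = \pi p, chars_tight (val p).1 & chars_tight (act p)]].

End InverseSemigroup.
Arguments projs : clear implicits.
Arguments pzero : clear implicits.
Arguments chars : clear implicits.
Arguments chars_infty : clear implicits.
Arguments chars_tight : clear implicits.
Arguments act_pairs : clear implicits.
Arguments Gtight : clear implicits.

Section L2.
Variable R : realType.
Local Notation C := R[i].

Definition sqnorm (z : C) : R := complex.Re z ^+ 2 + complex.Im z ^+ 2.

Definition square_summable (I : choiceType) (v : I -> C) : Prop :=
  (\esum_(i in [set: I]) (sqnorm (v i))%:E < +oo)%E.

Definition ell2 (I : choiceType) : set (I -> C) := [set v | square_summable v].
Arguments ell2 : clear implicits.

Lemma sqnorm_ge0 (z : C) : 0 <= sqnorm z.
Proof. by rewrite addr_ge0 ?sqr_ge0. Qed.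

Lemma sqnorm0 : sqnorm 0 = 0.
Proof. by rewrite /sqnorm /= !expr0n/= addr0. Qed.

Section Ell2.
Variable I : choiceType.

Lemma ell2P (v : ell2 I) : square_summable (val v).
Proof. by have /set_mem := valP v. Qed.

(** sum of an absolutely summable real family *)
Definition rsum (f : I -> R) : R :=
  fine (esum [set: I] (EFin \o f)^\+ - esum [set: I] (EFin \o f)^\-)%E.

Definition inner (u v : ell2 I) : C :=
  let w i := val u i * conjc (val v i) in
  Complex (rsum (fun i => complex.Re (w i))) (rsum (fun i => complex.Im (w i))).

Definition is_adjoint (A B : ell2 I -> ell2 I) : Prop :=
  forall u v, inner (A u) v = inner u (B v).

(** [pcomp s] is the operator [v |-> v \o s] for a partial map [s], zero where
    [s] is undefined. *)
Definition pcomp (s : I -> option I) (v : I -> C) (x : I) : C :=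
  if s x is Some y then v y else 0.

Definition pinv (s t : I -> option I) : Prop :=
  forall x y, s x = Some y <-> t y = Some x.

Lemma pinv_sym s t : pinv s t -> pinv t s.
Proof. by move=> st x y; split=> /st. Qed.

Lemma pinv_bij s t : pinv s t ->
  set_bij [set x | s x] [set y | t y] (fun x => odflt x (s x)).
Proof.
move=> st; split.
- move=> x /=; case E : (s x) => [y|]//= _.
  by move/st : E => ->.
- move=> x y; rewrite !inE/=; case E : (s x) => [x'|]//= _.
  case F : (s y) => [y'|]//= _ xy; move/st : E; move/st : F.
  by rewrite -xy => -> [].
- move=> y /=; case E : (t y) => [x|]//= _; exists x; move/st : E => /= -> //.
Qed.

Lemma esum_pinv s t (f : I -> I -> \bar R) : pinv s t ->
  (\esum_(x in [set: I]) (if s x is Some y then f x y else 0) =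
   \esum_(y in [set: I]) (if t y is Some x then f x y else 0))%E.
Proof.
move=> st.
transitivity (\esum_(x in [set x | s x]) (if s x is Some y then f x y else 0))%E.
  rewrite [RHS]esum_mkcond; apply: eq_esum => x _.
  by case: ifPn => //; rewrite notin_setE/=; case: (s x).
transitivity (\esum_(y in [set y | t y]) (if t y is Some x then f x y else 0))%E; last first.
  rewrite [LHS]esum_mkcond; apply: eq_esum => x _.
  by case: ifPn => //; rewrite notin_setE/=; case: (t x).
rewrite [RHS](reindex_esum _ _ (fun x => odflt x (s x)) _ (pinv_bij st)); apply: eq_esum => x /=.
by case E : (s x) => [y|]//= _; move/st : E => ->.
Qed.

Lemma square_summable_pcomp s t v : pinv s t ->
  square_summable v -> square_summable (pcomp s v).
Proof.
move=> st; apply: le_lt_trans.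
rewrite (_ : esum _ _ = \esum_(x in [set: I])
   (if s x is Some y then (sqnorm (v y))%:E else 0))%E; last first.
  apply: eq_esum => x _; rewrite /pcomp; case: (s x) => //.
  by rewrite sqnorm0.
rewrite (esum_pinv (fun _ y => (sqnorm (v y))%:E) st).
by apply: le_esum => y _; case: (t y); rewrite // lee_fin sqnorm_ge0.
Qed.

Lemma rsum_pinv s t (f : I -> I -> R) : pinv s t ->
  rsum (fun x => if s x is Some y then f x y else 0) =
  rsum (fun y => if t y is Some x then f x y else 0).
Proof.
move=> st; rewrite /rsum; congr (fine (_ - _)%E).
  have := esum_pinv (fun x y => maxe (f x y)%:E 0%E) st.
  move=> H; etransitivity; last (etransitivity; first exact: H).
    apply: eq_esum => x _; rewrite funeposE/=; case: (s x) => //.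
    by rewrite maxxx.
  apply: eq_esum => x _; rewrite funeposE/=; case: (t x) => //.
  by rewrite maxxx.
have := esum_pinv (fun x y => maxe (- (f x y)%:E)%E 0%E) st.
move=> H; etransitivity; last (etransitivity; first exact: H).
  apply: eq_esum => x _; rewrite funenegE/=; case: (s x) => //.
  by rewrite ?oppr0 ?oppe0 maxxx.
apply: eq_esum => x _; rewrite funenegE/=; case: (t x) => //.
by rewrite ?oppr0 ?oppe0 maxxx.
Qed.

Lemma is_adjoint_pcomp s t (A B : ell2 I -> ell2 I) : pinv s t ->
  (forall v, val (A v) = pcomp s (val v)) ->
  (forall v, val (B v) = pcomp t (val v)) -> is_adjoint A B.
Proof.
move=> st hA hB u v; rewrite /inner hA hB /pcomp; congr Complex.
  have := rsum_pinv (fun x y => complex.Re (val u y * conjc (val v x))) st.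
  congr (rsum _ = rsum _); apply/funext => x.
    by case: (s x) => //; rewrite mul0r.
  by case: (t x) => //; rewrite conjc0 mulr0.
have := rsum_pinv (fun x y => complex.Im (val u y * conjc (val v x))) st.
congr (rsum _ = rsum _); apply/funext => x.
  by case: (s x) => //; rewrite mul0r.
by case: (t x) => //; rewrite conjc0 mulr0.
Qed.

Lemma esum_supp1 (f : I -> \bar R) y : (forall x, x <> y -> f x = 0%E) ->
  (0 <= f y)%E -> (\esum_(x in [set: I]) f x = f y)%E.
Proof.
move=> f0 fy; rewrite -(esum_set1 fy) [RHS]esum_mkcond.
apply: eq_esum => x _; case: ifPn => //; rewrite notin_setE/= => xy.
exact: f0.
Qed.

Lemma rsum_supp1 (f : I -> R) y : (forall x, x <> y -> f x = 0) -> rsum f = f y.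
Proof.
move=> f0; rewrite /rsum (@esum_supp1 _ y); last 2 first.
- by move=> x /f0 fx; rewrite funeposE/= fx maxxx.
- by rewrite funeposE le_max lexx orbT.
rewrite (@esum_supp1 _ y); last 2 first.
- by move=> x /f0 fx; rewrite funenegE/= fx ?oppr0 ?oppe0 maxxx.
- by rewrite funenegE le_max lexx orbT.
rewrite funeposE funenegE/= -?EFinN -!EFin_max -EFinB/=.
case: (leP 0 (f y)) => h.
  by rewrite (max_idPr _) ?oppr_le0// subr0.
by rewrite (max_idPl _) ?oppr_ge0 ?(ltW h)// sub0r opprK.
Qed.

Lemma basis_vec_summable (y : I) :
  square_summable (fun x => (x == y)%:R : C).
Proof.
rewrite /square_summable (@esum_supp1 _ y) ?ltry// ?lee_fin ?sqnorm_ge0//.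
by move=> x /eqP /negbTE ->; rewrite sqnorm0.
Qed.

Definition basis_vec (y : I) : ell2 I :=
  exist _ (fun x => (x == y)%:R : C) (mem_set (basis_vec_summable y)).

Lemma inner_basis_vec y (v : ell2 I) : inner (basis_vec y) v = conjc (val v y).
Proof.
rewrite /inner /= !(@rsum_supp1 _ y) ?eqxx ?mul1r.
- by case: (conjc _).
- by move=> x /eqP /negbTE ->; rewrite mul0r.
- by move=> x /eqP /negbTE ->; rewrite mul0r.
Qed.

Lemma adjoint_unique (A B B' : ell2 I -> ell2 I) :
  is_adjoint A B -> is_adjoint A B' -> B = B'.
Proof.
move=> h h'; apply/funext => v; apply/val_inj/funext => y.
have := h' (basis_vec y) v; rewrite h !inner_basis_vec => /(congr1 conjc).
by rewrite !conjcK.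
Qed.

Lemma pcomp_inj s s' : (forall v : ell2 I, pcomp s (val v) = pcomp s' (val v)) ->
  s = s'.
Proof.
move=> h; apply/funext => x.
have [y [E|E]] : exists y, s x = Some y \/ s' x = Some y \/ s x = s' x.
  by case: (s x) => [y|]; [exists y; left|case: (s' x) => [y|]; [exists y|exists x]; auto].
- have := congr1 (fun f => f x) (h (basis_vec y)); rewrite /pcomp E /= eqxx.
  case: (s' x) => [z|]; last by move/eqP; rewrite oner_eq0.
  by case: (z =P y) => [->//|_ /eqP]; rewrite oner_eq0.
- case: E => // E.
  have := congr1 (fun f => f x) (h (basis_vec y)); rewrite /pcomp E /= eqxx.
  case: (s x) => [z|]; last by move/esym/eqP; rewrite oner_eq0.
  by case: (z =P y) => [->//|_ /esym/eqP]; rewrite oner_eq0.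
Qed.

End Ell2.
End L2.
Arguments ell2 R I : clear implicits.

Section Operators.
Variable R : realType.
Local Notation C := R[i].

(** The left shift [S], the right shift [S^*], the projection [|e_0><e_0|] and
    the powers of the bilateral shift, by their action on coordinates. *)
Definition Sop (v : nat -> C) (n : nat) : C := v n.+1.
Definition Sadj (v : nat -> C) (n : nat) : C := if n is n'.+1 then v n' else 0.
Definition pop (v : nat -> C) (n : nat) : C := if n == 0 then v 0 else 0.
Definition tpow (k : int) (v : int -> C) (z : int) : C := v (z - k).

Lemma Sadj_adjoint (A B : ell2 R nat -> ell2 R nat) :
  (forall v, val (A v) = Sop (val v)) -> (forall v, val (B v) = Sadj (val v)) ->
  is_adjoint A B.
Proof.
move=> hA hB.
pose t (n : nat) := if n is n'.+1 then Some n' else None.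
apply: (@is_adjoint_pcomp _ _ (fun n => Some n.+1) t) => [x [|y]|v|v].
- by split.
- by split=> -[->].
- by rewrite hA.
- by rewrite hB; apply/funext => -[|n].
Qed.

Variable l : nat.

Definition multi := {ffun 'I_l -> nat}.
Definition hidx : choiceType := (multi * int)%type.

Definition upd (x : multi) (i : 'I_l) (n : nat) : multi :=
  [ffun j => if j == i then n else x j].

(** An operator acting on one tensor factor, i.e. tensored with identities. *)
Definition amp (i : 'I_l) (A : (nat -> C) -> nat -> C) (v : hidx -> C)
  (x : hidx) : C := A (fun n => v (upd x.1 i n, x.2)) (x.1 i).
Definition ampZ (A : (int -> C) -> int -> C) (v : hidx -> C) (x : hidx) : C :=
  A (fun z => v (x.1, z)) x.2.

(** [A_1 (x) ... (x) A_l (x) D] on $\ell^2(\mathbb N)^{\otimes\ell}\otimes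
    \ell^2(\mathbb Z)=\ell^2(\mathbb N^\ell\times\mathbb Z)$ *)
Definition tensor (A : 'I_l -> (nat -> C) -> nat -> C)
    (D : (int -> C) -> int -> C) : (hidx -> C) -> hidx -> C :=
  (\big[comp/idfun]_(i < l) amp i (A i)) \o ampZ D.

(** Tensor positions are numbered from 0: [Bfun k r m n] is the formula for
    $B_{k+1}(r,m,n)$, and [k = l] gives $B_{\ell+1}$. *)
Definition leg (k : nat) (m n : multi) (i : 'I_l) : (nat -> C) -> nat -> C :=
  if (i < k)%N then iter (m i) Sadj \o pop \o iter (n i) Sop
  else if i == k :> nat then iter (m i) Sadj \o iter (n i) Sop
  else idfun.

Definition texp (k : nat) (r : int) (m n : multi) : int :=
  (if k == l then r else 0) +
  \sum_(i < l | (i <= k)%N) ((m i)%:Z - (n i)%:Z).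

Definition Bfun (k : 'I_l.+1) (r : int) (m n : multi) :
    (hidx -> C) -> hidx -> C :=
  tensor (leg k m n) (tpow (texp k r m n)).

(** [Bfun] is [pcomp] of the following partial map. *)
Definition bdom (k : nat) (m x : multi) : bool :=
  [forall i : 'I_l, if (i < k)%N then x i == m i
                    else (i == k :> nat) ==> (m i <= x i)%N].

Definition bval (k : nat) (m n x : multi) : multi :=
  [ffun i : 'I_l => if (i < k)%N then n i
            else if i == k :> nat then (x i - m i + n i)%N else x i].

Definition bmap (k : nat) (r : int) (m n : multi) (x : hidx) : option hidx :=
  if bdom k m x.1 then Some (bval k m n x.1, x.2 - texp k r m n) else None.

Definition smap (k : nat) (m n : multi) (i : 'I_l) (j : nat) : option nat :=
  if (i < k)%N then (if j == m i then Some (n i) else None)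
  else if i == k :> nat then (if (m i <= j)%N then Some (j - m i + n i)%N else None)
  else Some j.

Lemma iter_Sop n (v : nat -> C) j : iter n Sop v j = v (j + n)%N.
Proof. by elim: n j => [|n IH] j; rewrite ?addn0//= /Sop IH addSnnS. Qed.

Lemma iter_Sadj m (v : nat -> C) j :
  iter m Sadj v j = if (m <= j)%N then v (j - m)%N else 0.
Proof.
elim: m j => [|m IH] j; first by rewrite subn0.
by case: j => [|j] //=; rewrite IH ltnS subSS.
Qed.

Lemma legE k m n i v j : leg k m n i v j = pcomp (smap k m n i) v j.
Proof.
rewrite /leg /smap /pcomp; case: ifP => _ /=.
  rewrite iter_Sadj; case: (ltngtP j (m i)) => [h|h|->].
  - by [].
  - by rewrite /pop subn_eq0 leqNgt h.
  - by rewrite subnn /pop eqxx iter_Sop.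
case: ifP => _ //=; rewrite iter_Sadj; case: ifP => // _.
by rewrite iter_Sop.
Qed.

Lemma big_ampE k m n (s : seq 'I_l) (w : hidx -> C) x : uniq s ->
  (\big[comp/idfun]_(i <- s) amp i (leg k m n i)) w x =
  if all (fun i => isSome (smap k m n i (x.1 i))) s
  then w ([ffun i => if i \in s then odflt 0%N (smap k m n i (x.1 i)) else x.1 i], x.2)
  else 0.
Proof.
elim: s x => [|i s IH] x.
  rewrite big_nil /= => _; congr (w _); case: x => a b; congr pair.
  by apply/ffunP => i; rewrite ffunE.
rewrite big_cons /= => /andP[is_ us].
rewrite /amp /= legE /pcomp; case E : (smap _ _ _ _ _) => [j|]//=.
rewrite IH //=.
have H h : h \in s -> upd x.1 i j h = x.1 h.
  by move=> hs; rewrite ffunE; case: eqP => // hi; rewrite -hi hs in is_.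
have -> : all (fun h => isSome (smap k m n h (upd x.1 i j h))) s =
          all (fun h => isSome (smap k m n h (x.1 h))) s.
  by apply: eq_in_all => h hs; rewrite H.
case: ifP => // _; congr (w (_, _)); apply/ffunP => h; rewrite !ffunE in_cons.
case hi : (h == i) => /=; first by rewrite (eqP hi) E (negbTE is_).
by case: ifP.
Qed.

Lemma BfunE k r m n v : Bfun k r m n v = pcomp (bmap k r m n) v.
Proof.
apply/funext => x; rewrite /Bfun /tensor /= big_ampE ?index_enum_uniq//.
rewrite /pcomp /bmap.
have -> : all (fun i => isSome (smap k m n i (x.1 i))) (index_enum 'I_l) = bdom k m x.1.
  apply/allP/forallP => h i.
    have := h i (mem_index_enum _); rewrite /smap; case: ifP => _; first by case: eqP.
    by case: ifP => //= _; case: ifP.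
  move=> _; have := h i; rewrite /smap; case: ifP => _; first by case: eqP.
  by case: ifP => //= _; case: ifP.
case: ifP => // bd; rewrite /ampZ /tpow /=; congr (v (_, _)).
apply/ffunP => i; rewrite !ffunE mem_index_enum.
have := forallP bd i; rewrite /smap; case: ifP => [_ ->//|_].
by case: ifP => //= _ ->.
Qed.

Lemma texpN k r m n : texp k (- r) n m = - texp k r m n.
Proof.
rewrite /texp opprD -sumrN; congr (_ + _); first by case: ifP; rewrite ?oppr0.
by apply: eq_bigr => i _; rewrite opprB.
Qed.

Lemma bmap_inv k r m n x y :
  bmap k r m n x = Some y -> bmap k (- r) n m y = Some x.
Proof.
rewrite /bmap; case: ifP => // bd [<-] /=.
have -> : bdom k n (bval k m n x.1).
  apply/forallP => i; rewrite ffunE; case: (i < k)%N => /=; first exact: eqxx.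
  by apply/implyP => ->; rewrite leq_addl.
rewrite texpN opprK subrK; congr Some; case: x bd => x z /= bd; congr pair.
apply/ffunP => i; rewrite !ffunE; have := forallP bd i.
case: (i < k)%N => [/eqP //|]; case: (i == k :> nat) => //= h.
by rewrite addnK subnK.
Qed.

Lemma bmap_pinv k r m n : pinv (bmap k r m n) (bmap k (- r) n m).
Proof.
by move=> x y; split=> /bmap_inv //; rewrite opprK.
Qed.

Local Notation H := (ell2 R hidx).

Lemma Bfun_summable k r m n (v : H) :
  square_summable (Bfun k r m n (val v)).
Proof.
by rewrite BfunE; apply: (square_summable_pcomp (bmap_pinv _ _ _ _)); exact: ell2P.
Qed.

(** $B_{k+1}(r,m,n)$ as an operator on $\ell^2(\mathbb N^\ell\times\mathbb Z)$ *)
Definition Bop (k : 'I_l.+1) (r : int) (m n : multi) (v : H) : H :=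
  exist _ (Bfun k r m n (val v)) (mem_set (Bfun_summable k r m n v)).

Lemma zero_summable : square_summable (fun _ : hidx => 0 : C).
Proof.
rewrite /square_summable esum1 ?ltry// => i _.
by rewrite sqnorm0.
Qed.

Definition zop (v : H) : H :=
  exist _ (fun _ => 0) (mem_set zero_summable).

Definition Tset : set (H -> H) :=
  [set A | A = zop \/ exists k r m n, A = Bop k r m n].

Lemma zopE v : val (zop v) = pcomp (fun=> None) (val v).
Proof. by []. Qed.

Lemma BopE k r m n v : val (Bop k r m n v) = pcomp (bmap k r m n) (val v).
Proof. exact: BfunE. Qed.

Lemma Tset_zop : Tset zop. Proof. by left. Qed.

Lemma Tset_Bop k r m n : Tset (Bop k r m n).
Proof. by right; exists k, r, m, n. Qed.

Lemma zop_comp A : zop \o A = zop.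
Proof. by apply/funext => v; apply/val_inj. Qed.

Lemma pcomp_pcomp (s t : hidx -> option hidx) (v : hidx -> C) :
  pcomp s (pcomp t v) = pcomp (fun x => obind t (s x)) v.
Proof. by apply/funext => x; rewrite /pcomp; case: (s x). Qed.

Section Product.
Variables (k k' : 'I_l.+1) (r r' : int) (m n m' n' : multi).

Definition compat : bool := [forall i : 'I_l,
  if (i < k)%N then
    (if (i < k')%N then n i == m' i else (i == k' :> nat) ==> (m' i <= n i)%N)
  else (i == k :> nat) ==> (i < k')%N ==> (n i <= m' i)%N].

Definition prod_m : multi := [ffun i : 'I_l =>
  if (i < k)%N then m i
  else if i == k :> nat then
    (if (k <= k')%N then m i + (m' i - n i) else m i)%N
  else m' i].

Definition prod_n : multi := [ffun i : 'I_l =>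
  if (i < k')%N then n' i
  else if i == k' :> nat then
    (if (k' <= k)%N then n' i + (n i - m' i) else n' i)%N
  else n i].

Definition prod_k : 'I_l.+1 := if (k <= k')%N then k' else k.
Definition prod_r : int :=
  (if k == l :> nat then r else 0) + (if k' == l :> nat then r' else 0).

Lemma bdom_prod x :
  bdom k m x && bdom k' m' (bval k m n x) = compat && bdom prod_k prod_m x.
Proof.
have P (P1 P2 P3 P4 : pred 'I_l) : (forall i, P1 i && P2 i = P3 i && P4 i) ->
    [forall i, P1 i] && [forall i, P2 i] = [forall i, P3 i] && [forall i, P4 i].
  move=> h; apply/andP/andP => -[/forallP h1 /forallP h2]; split; apply/forallP => i;
    have := h i; rewrite h1 h2 /=.
  - by move/esym/andP => [].
  - by move/esym/andP => [].
  - by move/andP => [].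
  - by move/andP => [].
apply: P => i; rewrite !ffunE /prod_k.
have ik : (i < l)%N by [].
by case: (leqP k k') => kk; case: (ltngtP i k) => h1; case: (ltngtP i k') => h2 /=; lia.
Qed.

Lemma texp_prod : compat ->
  texp k r m n + texp k' r' m' n' = texp prod_k prod_r prod_m prod_n.
Proof.
move=> cp; rewrite /texp addrACA.
congr (_ + _).
  rewrite /prod_r /prod_k; have := ltn_ord k; have := ltn_ord k'.
  rewrite !ltnS => h1 h2.
  case: (leqP k k') => kk; case: eqP => e1; case: eqP => e2 //; lia.
rewrite !(big_mkcond (fun i : 'I_l => _ <= _)%N) -big_split /=.
apply: eq_bigr => i _; rewrite !ffunE /prod_k; have := forallP cp i.
by case: (leqP k' k) => kk'; case: (leqP k k') => kk; case: (ltngtP i k) => h1; case: (ltngtP i k') => h2 /=; lia.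
Qed.

Lemma bmap_prod x : obind (bmap k' r' m' n') (bmap k r m n x) =
  if compat then bmap prod_k prod_r prod_m prod_n x else None.
Proof.
have := bdom_prod x.1; rewrite /bmap.
case: (boolP compat) => [cp|cp] /=; last first.
  by case: (bdom k m x.1) => //= ->.
case: (boolP (bdom k m x.1)) => /= bd => [bd'|<-//].
rewrite bd'; case: (boolP (bdom prod_k _ _)) => // bd2; congr (Some (_, _)); last first.
  by rewrite -texp_prod// (opprD (texp _ _ _ _)) addrA.
apply/ffunP => i; rewrite !ffunE /prod_k.
have := forallP cp i; have := forallP bd i; have := forallP bd2 i.
rewrite !ffunE /prod_k.
by case: (leqP k' k) => kk'; case: (leqP k k') => kk; case: (ltngtP i k) => h1; case: (ltngtP i k') => h2 /=; lia.
Qed.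

Lemma Bop_comp : Bop k r m n \o Bop k' r' m' n' =
  if compat then Bop prod_k prod_r prod_m prod_n else zop.
Proof.
apply/funext => v; apply/val_inj; rewrite /= BfunE BfunE pcomp_pcomp.
transitivity (pcomp (fun x => if compat then bmap prod_k prod_r prod_m prod_n x else None) (val v)).
  by congr pcomp; apply/funext => x; exact: bmap_prod.
by case: ifP => _; rewrite /= ?BfunE.
Qed.
End Product.

End Operators.

Section SemigroupT.
Variables (R : realType) (l : nat).
Local Notation X := (hidx l).
Local Notation H := (ell2 R X).
Local Notation Tset := (@Tset R l).
Local Notation Bop := (@Bop R l).
Local Notation zop := (@zop R l).

Definition has_pmap (A : H -> H) (s : X -> option X) : Prop :=
  forall v, val (A v) = pcomp s (val v).

Lemma has_pmap_inj A B s : has_pmap A s -> has_pmap B s -> A = B.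
Proof. by move=> hA hB; apply/funext => v; apply/val_inj; rewrite hA hB. Qed.

Lemma has_pmap_uniq A s t : has_pmap A s -> has_pmap A t -> s = t.
Proof. by move=> hs ht; apply: (@pcomp_inj R) => v; rewrite -hs -ht. Qed.

Lemma has_pmap_comp A B s t : has_pmap A s -> has_pmap B t ->
  has_pmap (A \o B) (fun x => obind t (s x)).
Proof. by move=> hs ht v; rewrite /= hs ht pcomp_pcomp. Qed.

Lemma Tset_adjoint A : Tset A -> exists B s t,
  [/\ Tset B, has_pmap A s, has_pmap B t & pinv s t].
Proof.
case=> [->|[k [r [m [n ->]]]]].
  by exists zop, (fun=> None), (fun=> None); split; [exact: Tset_zop|by []|by []|by split].
exists (Bop k (- r) n m), (bmap k r m n), (bmap k (- r) n m).
split; [exact: Tset_Bop| | |exact: bmap_pinv].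
  by move=> v; exact: BopE.
by move=> v; exact: BopE.
Qed.

Lemma Tset_mul A B : Tset A -> Tset B -> Tset (A \o B).
Proof.
move=> TA; case=> [->|[k' [r' [m' [n' ->]]]]].
  left; case: TA => [->|[k [r [m [n ->]]]]]; first exact: zop_comp.
  apply: (@has_pmap_inj _ _ (fun=> None)) => [v|v //].
  rewrite /= BfunE; apply/funext => x; rewrite /pcomp.
  by case: (bmap _ _ _ _ _).
case: TA => [->|[k [r [m [n ->]]]]]; first by left.
by rewrite Bop_comp; case: ifP => _; [exact: Tset_Bop|exact: Tset_zop].
Qed.

Definition Top : choiceType := set_type Tset.

Lemma TopP (s : Top) : Tset (val s).
Proof. by have /set_mem := valP s. Qed.

Definition top_of (A : H -> H) (TA : Tset A) : Top := exist _ A (mem_set TA).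

Definition top_mul (s t : Top) : Top := top_of (Tset_mul (TopP s) (TopP t)).
Definition top_zero : Top := top_of (Tset_zop R l).
Definition top_B (k : 'I_l.+1) (r : int) (m n : multi l) : Top :=
  top_of (Tset_Bop R k r m n).

Lemma top_adjoint_ex (s : Top) : exists t : Top, is_adjoint (val s) (val t).
Proof.
have [B [f [g [TB hA hB fg]]]] := Tset_adjoint (TopP s).
by exists (top_of TB); exact: is_adjoint_pcomp fg hA hB.
Qed.

(** The Hilbert space adjoint, which is unique by [adjoint_unique]. *)
Definition top_star (s : Top) : Top := sval (cid (top_adjoint_ex s)).

Lemma top_starP (s : Top) : is_adjoint (val s) (val (top_star s)).
Proof. by rewrite /top_star; case: cid. Qed.

Lemma top_star_pmap (s : Top) : exists f g,
  [/\ has_pmap (val s) f, has_pmap (val (top_star s)) g & pinv f g].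
Proof.
have [B [f [g [TB hA hB fg]]]] := Tset_adjoint (TopP s).
exists f, g; split=> //.
by rewrite (adjoint_unique (@top_starP s) (is_adjoint_pcomp fg hA hB)).
Qed.

Lemma top_mulA : associative top_mul.
Proof. by move=> s t u; apply/val_inj. Qed.

Lemma top_mulK s : top_mul (top_mul s (top_star s)) s = s.
Proof.
have [f [g [hf hg fg]]] := top_star_pmap s; apply/val_inj.
apply: (has_pmap_inj (has_pmap_comp (has_pmap_comp hf hg) hf)).
suff <- : f = (fun x => obind f (obind g (f x))) by [].
apply/funext => x; case E : (f x) => [y|] //=.
by have /fg -> /= := E; rewrite E.
Qed.

Lemma top_starK s : top_mul (top_mul (top_star s) s) (top_star s) = top_star s.
Proof.
have [f [g [hf hg fg]]] := top_star_pmap s; apply/val_inj.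
apply: (has_pmap_inj (has_pmap_comp (has_pmap_comp hg hf) hg)).
suff <- : g = (fun x => obind g (obind f (g x))) by [].
apply/funext => x; case E : (g x) => [y|] //=.
by have /fg -> /= := E; rewrite E.
Qed.

Lemma top_star_unique s t : top_mul (top_mul s t) s = s ->
  top_mul (top_mul t s) t = t -> t = top_star s.
Proof.
have [f [g [hf hg fg]]] := top_star_pmap s.
have [_ [h [h' [_ hh _ hi]]]] := Tset_adjoint (TopP t).
move=> /(congr1 val) sts /(congr1 val) tst.
have {}sts : (fun x => obind f (obind h (f x))) = f.
  apply: (@has_pmap_uniq (val s)) => //; rewrite -[X in has_pmap X]sts.
  exact: has_pmap_comp (has_pmap_comp hf hh) hf.
have {}tst : (fun x => obind h (obind f (h x))) = h.
  apply: (@has_pmap_uniq (val t)) => //; rewrite -[X in has_pmap X]tst.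
  exact: has_pmap_comp (has_pmap_comp hh hf) hh.
apply/val_inj; apply: (has_pmap_inj hh); suff -> : h = g by [].
have hinj x y z : h x = Some z -> h y = Some z -> x = y.
  by move=> /hi E /hi; rewrite E => -[].
have finj x y z : f x = Some z -> f y = Some z -> x = y.
  by move=> /fg E /fg; rewrite E => -[].
have P y x : h y = Some x <-> g y = Some x.
  split=> E.
    have := congr1 (fun F => F y) tst; rewrite E /=.
    case F : (f x) => [y'|] //= E'; apply/fg; rewrite F; congr Some.
    exact: hinj E' E.
  have F : f x = Some y by apply/fg.
  have := congr1 (fun F => F x) sts; rewrite F /=.
  case E' : (h y) => [x'|] //= F'; congr Some.
  exact: finj F' F.
apply/funext => y; case E : (h y) => [x|]; first by move/P : E.
by case F : (g y) => [x|] //; move/P : F; rewrite E.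
Qed.

Lemma top_mul0s : left_zero top_zero top_mul.
Proof. by move=> s; apply/val_inj; exact: zop_comp. Qed.

Lemma top_muls0 : right_zero top_zero top_mul.
Proof.
move=> s; apply/val_inj; have [f [g [hf _ _]]] := top_star_pmap s.
apply: (@has_pmap_inj _ _ (fun=> None)) => [v|v //].
by rewrite /= hf; apply/funext => x; rewrite /pcomp; case: (f x).
Qed.

Definition Tsg : invSemigroup0 :=
  InvSemigroup0 top_mulA top_mulK top_starK top_star_unique
    top_mul0s top_muls0.

Definition Bsg (k : 'I_l.+1) (r : int) (m n : multi l) : Tsg := top_B k r m n.

Local Notation T := Tsg.

Lemma Bsg_pmap k r m n : has_pmap (val (Bsg k r m n)) (bmap k r m n).
Proof. by move=> v; exact: BopE. Qed.

Lemma proj_pmap (e : projs T) : exists f,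
  has_pmap (val (val e)) f /\ forall x y, f x = Some y -> x = y.
Proof.
have [ee _] := projP e; have [f [g [hf _ fg]]] := top_star_pmap (val e).
exists f; split=> // x y E.
have : (fun x => obind f (f x)) = f.
  apply: (@has_pmap_uniq (val (val e))) => //.
  have := congr1 val ee; rewrite /= => {1}<-.
  exact: has_pmap_comp.
move=> /(congr1 (fun F => F x)); rewrite E /= => F.
by move/fg : E; move/fg : F => -> [].
Qed.

(** the support of a projection of [T] *)
Definition pdom (e : projs T) (x : X) : bool :=
  val (val (val e) (basis_vec R x)) x != 0.

Lemma pdomE (e : projs T) f : has_pmap (val (val e)) f ->
  (forall x y, f x = Some y -> x = y) ->
  f = (fun x => if pdom e x then Some x else None).
Proof.
move=> hf id; apply/funext => x; rewrite /pdom hf /pcomp.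
case E : (f x) => [y|]; last by rewrite eqxx.
by have <- := id _ _ E; rewrite /= eqxx oner_neq0.
Qed.

Lemma pdomP (e : projs T) :
  has_pmap (val (val e)) (fun x => if pdom e x then Some x else None).
Proof. by have [f [hf id]] := proj_pmap e; rewrite -(pdomE hf id). Qed.

Lemma pdom_inj e f : (forall x, pdom e x = pdom f x) -> e = f.
Proof.
move=> h; apply/val_inj/val_inj; apply: (has_pmap_inj (pdomP e)).
suff -> : (fun x => if pdom e x then Some x else None) =
         (fun x => if pdom f x then Some x else None) by exact: pdomP.
by apply/funext => x; rewrite h.
Qed.

Lemma pdom_uniq (e : projs T) (D : X -> bool) :
  has_pmap (val (val e)) (fun x => if D x then Some x else None) ->
  forall x, pdom e x = D x.
Proof.
move=> h x; have := congr1 (fun F => F x) (has_pmap_uniq h (pdomP e)).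
by rewrite /=; case: (D x); case: (pdom e x).
Qed.

Lemma pdomM e f x : pdom (pmul e f) x = pdom e x && pdom f x.
Proof.
move: x; apply: pdom_uniq.
have := has_pmap_comp (pdomP e) (pdomP f).
congr (has_pmap _ _); apply/funext => x.
by case: (pdom e x).
Qed.

Lemma pdom0 x : pdom (pzero T) x = false.
Proof. by rewrite /pdom /= eqxx. Qed.

Lemma pdom_le e f : (forall x, pdom e x -> pdom f x) <-> proj_le e f.
Proof.
split=> [h|<- x]; last by rewrite pdomM => /andP[].
apply: pdom_inj => x; rewrite pdomM; have := h x.
by case: (pdom e x) => // ->.
Qed.

Lemma texp0 (k : nat) (m : multi l) : texp k 0 m m = 0.
Proof.
by rewrite /texp if_same add0r big1// => i _; rewrite subrr.
Qed.

Lemma bmap_diag (k : nat) (m : multi l) :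
  bmap k 0 m m = (fun x => if bdom k m x.1 then Some x else None).
Proof.
apply/funext => -[x z]; rewrite /bmap /= texp0 subr0.
case: ifP => // bd; congr (Some (_, _)); apply/ffunP => i; rewrite ffunE.
have := forallP bd i.
by case: (i < k)%N => [/eqP //|]; case: (i == k :> nat) => //= h; rewrite subnK.
Qed.

Lemma Bsg_proj k m : is_proj (Bsg k 0 m m).
Proof.
suff h : Bsg k 0 m m ** Bsg k 0 m m = Bsg k 0 m m.
  by split=> //; exact: star_idem.
apply/val_inj; apply: (has_pmap_inj (has_pmap_comp (Bsg_pmap k 0 m m) (Bsg_pmap k 0 m m))).
suff <- : bmap k 0 m m = (fun x => obind (bmap k 0 m m) (bmap k 0 m m x)).
  exact: Bsg_pmap.
rewrite bmap_diag; apply/funext => x.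
by case bd : (bdom k m x.1); rewrite //= bd.
Qed.

(** $p_{k+1}(m)$ *)
Definition pB (k : 'I_l.+1) (m : multi l) : projs T := proj_of (Bsg_proj k m).

Lemma pdom_pB k m x : pdom (pB k m) x = bdom k m x.1.
Proof.
by move: x; apply: pdom_uniq; have := Bsg_pmap k 0 m m; rewrite bmap_diag.
Qed.

Lemma pdom_range k r m n x : pdom (prange (Bsg k r m n)) x = bdom k m x.1.
Proof.
move: x; apply: pdom_uniq; have [f [g [hf hg fg]]] := top_star_pmap (Bsg k r m n).
have := has_pmap_comp hf hg; congr (has_pmap _ _); apply/funext => x.
have -> : f = bmap k r m n by apply: has_pmap_uniq hf (Bsg_pmap _ _ _ _).
case E : (bmap k r m n x) => [y|]; rewrite /=; last first.
  by move: E; rewrite /bmap; case: ifP.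
have -> : g y = Some x.
  by apply/fg; rewrite (has_pmap_uniq hf (Bsg_pmap _ _ _ _)).
by move: E; rewrite /bmap; case: ifP.
Qed.

Lemma proj_cases (e : projs T) : e = pzero T \/
  exists (k : 'I_l.+1) (m : multi l), forall x, pdom e x = bdom k m x.1.
Proof.
case: (TopP (val e)) => [h|[k [r [m [n h]]]]].
  by left; apply/val_inj/val_inj.
right; exists k, m => x.
have hB : has_pmap (val (val e)) (bmap k r m n).
  by rewrite h; move=> v; exact: BopE.
have := congr1 (fun F => F x) (has_pmap_uniq hB (pdomP e)).
by rewrite /bmap; case: ifP; case: ifP.
Qed.

End SemigroupT.

Section Phi.
Variables (R : realType) (l : nat).
Local Notation T := (Tsg R l).

(** For [k] in $\overline{\mathbb N}^\ell$, with [None] for infinity: the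
    number of coordinates before the first infinite one. *)
Definition fin_rank (k : 'I_l -> option nat) : 'I_l.+1 :=
  inord (find (fun i => k i == None) (enum 'I_l)).

Lemma fin_rank_fin k (i : 'I_l) : (i < fin_rank k)%N -> k i <> None.
Proof.
rewrite /fin_rank inordK; last first.
  by rewrite ltnS -[X in (_ <= X)%N](size_enum_ord l) find_size.
move=> h ki; have := before_find i h.
by rewrite (nth_ord_enum i i) ki eqxx.
Qed.

Lemma fin_rank_inf k (i : 'I_l) : i = fin_rank k :> nat -> k i = None.
Proof.
rewrite /fin_rank inordK; last first.
  by rewrite ltnS -[X in (_ <= X)%N](size_enum_ord l) find_size.
move=> h; have : has (fun i => k i == None) (enum 'I_l).
  by rewrite has_find -h size_enum_ord.
by move/(nth_find i); rewrite -h nth_ord_enum => /eqP.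
Qed.

(** $(\pi_r(k), n)$; only the coordinates of [n] from position [r] on matter *)
Definition proj_cat (r : nat) (k : 'I_l -> option nat) (n : multi l) : multi l :=
  [ffun i : 'I_l => if (i < r)%N then odflt 0%N (k i) else n i].

Definition phi_filter (k : 'I_l -> option nat) : set (projs T) :=
  [set f | exists n, proj_le (pB R (fin_rank k) (proj_cat (fin_rank k) k n)) f].

Definition phi_fun (k : 'I_l -> option nat) : {ptws projs T -> bool} :=
  fun f => `[< phi_filter k f >].

Lemma pB_ge k (n n' : multi l) : (forall i : 'I_l, i = fin_rank k :> nat -> (n i <= n' i)%N) ->
  proj_le (pB R (fin_rank k) (proj_cat (fin_rank k) k n'))
    (pB R (fin_rank k) (proj_cat (fin_rank k) k n)).
Proof.
move=> h; apply/pdom_le => x; rewrite !pdom_pB => bd; apply/forallP => i.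
have := forallP bd i; rewrite !ffunE; have := h i.
case: (i < _)%N => //; case: (i =P _ :> nat) => //= e /(_ e).
exact: leq_trans.
Qed.

Lemma bdom_self (k : nat) (m : multi l) : bdom k m m.
Proof. by apply/forallP => i; rewrite eqxx leqnn implybT if_same. Qed.

Lemma phi_is_char k : is_char (phi_fun k).
Proof.
split.
- exists (pB R (fin_rank k) (proj_cat (fin_rank k) k [ffun=> 0%N])).
  by apply/asboolP; exists [ffun=> 0%N]; exact: pmulee.
- move=> e f; apply/asboolP/andP => [[n /pdom_le h]|[/asboolP[n /pdom_le he] /asboolP[n' /pdom_le hf]]].
    by split; apply/asboolP; exists n; apply/pdom_le => x /h; rewrite pdomM => /andP[].
  exists [ffun i => maxn (n i) (n' i)]; apply/pdom_le => x hx; rewrite pdomM.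
  rewrite he ?hf//.
    by move: x hx; apply/pdom_le/pB_ge => i _; rewrite ffunE leq_maxr.
  by move: x hx; apply/pdom_le/pB_ge => i _; rewrite ffunE leq_maxl.
- apply/negbTE/asboolPn => -[n /pdom_le].
  move=> /(_ (proj_cat (fin_rank k) k n, 0)); rewrite pdom_pB pdom0.
  by rewrite bdom_self => /(_ isT).
Qed.

Definition phi (k : 'I_l -> option nat) : chars T :=
  exist _ (phi_fun k) (mem_set (phi_is_char k)).

Lemma phi_infty k : chars_infty T (phi k).
Proof.
split; first exact: char_filterP.
move=> A [_ A0 AM AU] phiA f Af; apply/asboolP.
have A1 g : phi_filter k g -> A g by move=> h; apply: phiA; exact/asboolP.
case: (proj_cases f) => [f0|[j [m fE]]]; first by rewrite f0 in Af.
pose M : multi l := [ffun i => (m i).+1].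
set p := pB R (fin_rank k) (proj_cat (fin_rank k) k M).
have Ap : A p by apply: A1; exists M; exact: pmulee.
have [x] : exists x, pdom (pmul f p) x.
  apply: contrapT => /forallNP h; apply: A0.
  suff <- : pmul f p = pzero T by exact: AM.
  by apply: pdom_inj => x; rewrite pdom0; apply/negbTE/negP/h.
rewrite pdomM fE pdom_pB => /andP[bf bp].
exists M; apply/pdom_le => y; rewrite fE pdom_pB => by_.
have [jr|jr] := leqP j (fin_rank k).
  apply/forallP => i; have := forallP by_ i; have := forallP bf i.
  have := forallP bp i; rewrite !ffunE.
  case: (ltngtP i j) => [ij|//|ij] /=.
    by rewrite (leq_trans ij jr) => /eqP <- /eqP <-.
  move: jr; rewrite -ij leq_eqVlt => /orP[/eqP ir|ir]; last first.
    by rewrite ir => /eqP <- ? /eqP ->.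
  by rewrite ir ltnn eqxx /= => _ _ /ltnW.
have rl : (fin_rank k < l)%N by rewrite (leq_trans jr)// -ltnS ltn_ord.
have := forallP bp (Ordinal rl); have := forallP bf (Ordinal rl).
by rewrite !ffunE /= jr ltnn eqxx /= => /eqP ->; rewrite ltnn.
Qed.

Lemma phi_tight k : chars_tight T (phi k).
Proof. by apply: subset_closure; exact: phi_infty. Qed.

End Phi.

(** The data of a topological groupoid: [gmul g h k] means that $gh$ is defined
    and equal to [k], and [ginv g h] that $g^{-1}=h$. The operations are given
    by their graphs, so that those of a quotient need no choice of
    representatives; the groupoid axioms are not part of the record. *)
Record topGroupoidData := TopGroupoidData {
  arrow :> topologicalType;
  gmul : arrow -> arrow -> arrow -> Prop;
  ginv : arrow -> arrow -> Prop }.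

Definition is_topGroupoid_iso (G K : topGroupoidData) (f : G -> K) : Prop :=
  [/\ (forall g h k, gmul g h k <-> gmul (f g) (f h) (f k)),
      (forall g h, ginv g h <-> ginv (f g) (f h))
    & exists f' : K -> G,
        [/\ cancel f f', cancel f' f, continuous f & continuous f']].

Definition tight_groupoid (T : invSemigroup0) : topGroupoidData :=
  @TopGroupoidData (Gtight T : Type)
    (fun g h k => germ_mul (val g) (val h) (val k))
    (fun g h => germ_inv (val g) (val h)).

HB.instance Definition _ := hasNbhs.Build int principal_filter.
HB.instance Definition _ := Discrete_ofNbhs.Build int erefl.

(** $\mathbb Z\cup\{+\infty\}$, with [None] for $+\infty$ *)
Definition zbar : Type := option int.
HB.instance Definition _ := Choice.on zbar.

Definition zbar_nbhs (w : zbar) : set_system zbar :=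
  if w is Some _ then principal_filter w
  else [set A | A None /\ exists N : int, forall a, N <= a -> A (Some a)].

Lemma zbar_nbhs_filter w : ProperFilter (zbar_nbhs w).
Proof.
case: w => [a|]; first exact: principal_filter_proper.
split; first by case.
split=> [|A B [A0 [N AN]] [B0 [M BM]]|A B AB [A0 [N AN]]].
- by split=> //; exists 0.
- split=> //; exists (Num.max N M) => a; rewrite ge_max => /andP[Na Ma].
  by split; [exact: AN|exact: BM].
- by split; [exact: AB|exists N => a /AN /AB].
Qed.

Lemma zbar_nbhs_singleton w A : zbar_nbhs w A -> A w.
Proof. by case: w => [a /principal_filterP|[]]. Qed.

Lemma zbar_nbhs_nbhs w A : zbar_nbhs w A -> zbar_nbhs w (zbar_nbhs^~ A).
Proof.
case: w => [a /= Aa|[A0 [N AN]]].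
  by apply/principal_filterP.
split; first by split=> //; exists N.
by exists N => a Na; apply/principal_filterP/AN.
Qed.

HB.instance Definition _ := hasNbhs.Build zbar zbar_nbhs.
HB.instance Definition _ := Nbhs_isNbhsTopological.Build zbar
  zbar_nbhs_filter zbar_nbhs_singleton zbar_nbhs_nbhs.

Section Sheu.
Variable l : nat.

Definition zbar_translate (w : 'I_l -> zbar) (x : 'I_l -> int) : {ptws 'I_l -> zbar} :=
  fun i => omap (+%R^~ (x i)) (w i).

(** the product of $\mathbb Z$ with the transformation groupoid
    $\mathbb Z^\ell\times\overline{\mathbb Z}^\ell$ *)
Definition ambient : Type :=
  (int * ({ptws 'I_l -> int} * {ptws 'I_l -> zbar}))%type.
HB.instance Definition _ := Topological.on ambient.
Implicit Types g h k : ambient.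

Definition am_z g : int := g.1.
Definition am_x g : 'I_l -> int := g.2.1.
Definition am_w g : 'I_l -> zbar := g.2.2.
Definition am_range g : 'I_l -> zbar := am_w g.
Definition am_source g : 'I_l -> zbar := zbar_translate (am_w g) (am_x g).

Definition am_mul g h k : Prop :=
  am_range h = am_source g /\
  k = (am_z g + am_z h, ((fun i => am_x g i + am_x h i), am_w g)).

Definition am_inv g h : Prop :=
  h = (- am_z g, ((fun i => - am_x g i), am_source g)).

(** $\overline{\mathbb N}^\ell$ inside $\overline{\mathbb Z}^\ell$ *)
Definition nbar (w : 'I_l -> zbar) : Prop :=
  forall i a, w i = Some a -> 0 <= a.

Definition calF : set ambient := [set g | nbar (am_range g) /\ nbar (am_source g)].

Definition Sigma : set ambient := [set g | calF g /\
  forall i : 'I_l, am_w g i = None ->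
    (forall j : 'I_l, (i < j)%N -> am_x g j = 0) /\
    am_z g = - \sum_(j < l | (j <= i)%N) am_x g j].

(** the generating pairs $(z,x,w)\sim(z,x,w_1,\dots,w_{i-1},\infty,\dots,\infty)$
    with $w_i=\infty$ *)
Definition sheu_step (g h : Sigma) : Prop := exists i : 'I_l,
  am_w (val g) i = None /\
  val h = (am_z (val g), (am_x (val g),
            fun j : 'I_l => if (j <= i)%N then am_w (val g) j else None)).

Definition sheu_eq : Sigma -> Sigma -> Prop := clos_refl_sym_trans Sigma sheu_step.

Definition sheu_eqb (g h : Sigma) : bool := `[< sheu_eq g h >].

Lemma sheu_eqb_refl : reflexive sheu_eqb.
Proof. by move=> g; apply/asboolP; exact: rst_refl. Qed.

Lemma sheu_eqb_sym : symmetric sheu_eqb.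
Proof. by move=> g h; apply/asboolP/asboolP; exact: rst_sym. Qed.

Lemma sheu_eqb_trans : transitive sheu_eqb.
Proof.
by move=> h g k /asboolP gh /asboolP hk; apply/asboolP; exact: rst_trans gh hk.
Qed.

Definition sheu_rel : equiv_rel Sigma :=
  EquivRel sheu_eqb sheu_eqb_refl sheu_eqb_sym sheu_eqb_trans.

Definition sheu : topologicalType := quotient_topology {eq_quot sheu_rel}.
Definition sheu_class (g : Sigma) : sheu := \pi_{eq_quot sheu_rel} g.

Definition sheu_groupoid : topGroupoidData :=
  @TopGroupoidData sheu
    (fun g h k : sheu => exists a b c : Sigma,
       [/\ g = sheu_class a, h = sheu_class b, k = sheu_class c
         & am_mul (val a) (val b) (val c)])
    (fun g h : sheu => exists a b : Sigma,
       [/\ g = sheu_class a, h = sheu_class b & am_inv (val a) (val b)]).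

End Sheu.
Arguments calF : clear implicits.
Arguments Sigma : clear implicits.

Section Psi.
Variables (R : realType) (l : nat).
Local Notation T := (Tsg R l).
Implicit Types g : ambient l.

(** On the elements of [Sigma], all the integers whose absolute value is taken
    as a natural number below are nonnegative, except $x_{r+1}$ in
    $|x_{r+1}|$. *)
Definition nat_part (w : 'I_l -> zbar) : 'I_l -> option nat :=
  fun i => omap absz (w i).

Definition psi_rank g : 'I_l.+1 := fin_rank (nat_part (am_w g)).

Definition psi_a g : int := am_z g + \sum_(j < l | (j < psi_rank g)%N) am_x g j.

Definition psi_m g : multi l := [ffun i : 'I_l =>
  if (i < psi_rank g)%N then odflt 0%N (nat_part (am_w g) i)
  else if i == psi_rank g :> nat then absz (am_x g i) else 0%N].

Definition psi_n g : multi l := [ffun i : 'I_l =>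
  if (i < psi_rank g)%N then odflt 0%N (nat_part (am_source g) i)
  else if i == psi_rank g :> nat then absz (am_x g i + `|am_x g i|) else 0%N].

Definition psi_B g : T := Bsg R (psi_rank g) (psi_a g) (psi_m g) (psi_n g).

Lemma psi_dom g : char_dom (psi_B g) (phi R (nat_part (am_w g))).
Proof.
apply/asboolP; exists (psi_m g); apply/pdom_le => x.
rewrite pdom_pB pdom_range => bd; apply/forallP => i.
have := forallP bd i; rewrite !ffunE -/(psi_rank g).
by case: (i < _)%N.
Qed.

Definition psi_pair g : act_pairs T := act_pair (psi_dom g).

Lemma psi_tight g : Gtight T (\pi_(germ T) (psi_pair g)).
Proof.
exists (psi_pair g); split=> //; first exact: phi_tight.
by apply: subset_closure; apply: chars_infty_act; exact: phi_infty.
Qed.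

Definition psi (g : Sigma l) : tight_groupoid T :=
  exist _ (\pi_(germ T) (psi_pair (val g))) (mem_set (psi_tight (val g))).

End Psi.

(* Main.v *)
From Stdlib Require Import Relation_Operators.
Require Import Defs.
From mathcomp Require Import all_boot all_order all_algebra.
From mathcomp Require Import zify.
From mathcomp Require Import all_classical all_reals topology.

(** Every nonzero element of the semigroup acts on the canonical basis, indexed
    by $\mathbb N^\ell\times\mathbb Z$, as the restriction to a subset of a
    translation $(y,c)\mapsto(y+x,c-z)$. Two elements have the same germ at a
    character exactly when their translation vectors $(x,z)$ agree
    ([germ_eq_shift]), so a germ is the same thing as a pair made of a
    character and a vector; products add vectors and inverses negate them. In
    these terms $\psi(z,x,w)$ is the pair $(\phi(w),(x,z))$
    ([psi_translates], [psi_at]), and the algebraic part of the proof reduces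
    to understanding $\phi$.

    The character $\phi(w)$ is a limit of point evaluations: for each projection
    $e$, $\phi(w)(e)=1$ if and only if $y$ lies in the support of $e$, for all
    $y\in\mathbb N^\ell$ close enough to $w$ ([Phi_lim]). This one fact gives
    - the continuity of $\phi$ ([Phi_continuous]);
    - the equivariance $\phi(w).s=\phi(w+x)$ when $s$ translates by $x$
      ([Phi_act]), hence the compatibility of $\psi$ with products and inverses;
    - that $(z,x,w)\in\Sigma$ whenever some $s$ with vector $(x,z)$ has $\phi(w)$
      in its domain ([domain_Sigma]);
    - that $\phi(w)$ determines $w$ up to and including its first infinite
      coordinate ([Phi_inj]), which is all that $\sim$ remembers of $w$.

    As $\overline{\mathbb N}^\ell$ is compact, the image of $\phi$ is closed; it
    contains every ultrafilter, by the finite intersection property, so it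
    contains all tight characters ([tight_Phi]), and $\psi$ is onto.

    It remains to compare topologies. Continuity of $\psi$ is immediate, since
    $\phi$ is continuous and vectors are locally constant on $\Sigma$. The map
    $\psi$ need not be open, but it sends saturated open sets $U$ to open sets
    ([psi_saturated_nbhs]): for
    $g=(z,x,w)\in U$ and $s$ the element used to define $\psi(g)$, let $C$ be the
    compact set of those $w'$ for which $\phi(w')\in D_s$ and $(z,x,w')\notin U$.
    Then $\phi(C)$ is closed and, by saturation, does not contain $\phi(w)$, so
    $\theta(s,D_s\setminus\phi(C))$ is a neighbourhood of $\psi(g)$, and it only
    meets $\psi(\Sigma)$ in images of points of $U$. *)

Set Implicit Arguments.
Unset Strict Implicit.
Unset Printing Implicit Defensive.

Import Order.TTheory GRing.Theory Num.Theory.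

Local Open Scope classical_set_scope.
Local Open Scope ring_scope.
Local Open Scope quotient_scope.

Local Notation "s ** t" := (smul s t) (at level 40, left associativity).

(** * The semigroup as partial translations *)

Section PartialMaps.
Variables (R : realType) (l : nat).
Local Notation T := (Tsg R l).
Local Notation X := (hidx l).
Implicit Types (s t : T) (e : projs T) (y : X).

Lemma pmap_ex s : exists f, has_pmap (val s) f.
Proof. by have [f [_ [? _ _]]] := top_star_pmap s; exists f. Qed.

Definition pmap s : X -> option X := sval (cid (pmap_ex s)).

Lemma pmapP s : has_pmap (val s) (pmap s).
Proof. exact: svalP (cid (pmap_ex s)). Qed.

Lemma pmap_uniq s f : has_pmap (val s) f -> pmap s = f.
Proof. exact/has_pmap_uniq/pmapP. Qed.

Lemma pmap_inj s t : pmap s =1 pmap t -> s = t.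
Proof.
move=> /funext st; apply/val_inj/(has_pmap_inj (pmapP s)).
by rewrite st; exact: pmapP.
Qed.

Lemma pmapM s t y : pmap (s ** t) y = obind (pmap t) (pmap s y).
Proof.
by rewrite (pmap_uniq (s := s ** t) (has_pmap_comp (pmapP s) (pmapP t))).
Qed.

Lemma pmap_star s : Defs.pinv (pmap s) (pmap (star s)).
Proof.
have [f [g [hf hg fg]]] := top_star_pmap s.
by rewrite (pmap_uniq hf) (@pmap_uniq (star s) g hg).
Qed.

Lemma pmap_proj e y : pmap (val e) y = if pdom e y then Some y else None.
Proof. by rewrite (pmap_uniq (pdomP e)). Qed.

Lemma pmap_zero y : pmap (szero : T) y = None.
Proof. by rewrite (@pmap_uniq szero (fun=> None) (@zopE R l)). Qed.

Lemma pmap_B k r m n : pmap (Bsg R k r m n) = bmap k r m n.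
Proof. exact/pmap_uniq/Bsg_pmap. Qed.

(** Operators compose on functions, so the partial maps compose in the reverse
    order: the range projection of [s] lives on the domain of [pmap s], and
    conjugation by [s] pulls supports back along [pmap s]. *)
Lemma pdom_conj s e y :
  pdom (pconj s e) y = if pmap s y is Some y' then pdom e y' else false.
Proof.
have : isSome (pmap (s ** val e ** star s) y) = pdom (pconj s e) y.
  by rewrite (pmap_proj (pconj s e)); case: ifP.
rewrite !pmapM => <-; case E : (pmap s y) => [y'|] //=.
rewrite pmap_proj; case: ifP => // _ /=.
by have /pmap_star -> := E.
Qed.

Lemma pdom_prange s y : pdom (prange s) y = isSome (pmap s y).
Proof.
have : isSome (pmap (s ** star s) y) = pdom (prange s) y.
  by rewrite (pmap_proj (prange s)); case: ifP.
rewrite pmapM => <-; case E : (pmap s y) => [y'|] //=.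
by have /pmap_star -> := E.
Qed.

Lemma Tsg_cases s : s = szero \/ exists k r m n, s = Bsg R k r m n.
Proof.
by case: (TopP s) => [h|[k [r [m [n h]]]]]; [left|right; exists k, r, m, n];
  exact/val_inj.
Qed.

(** The sign of [z] is that of the exponent of $t$: the power $t^z$ of the
    bilateral shift acts on functions by precomposition with $c\mapsto c-z$. *)
Definition translates s (x : 'I_l -> int) (z : int) : Prop :=
  forall y y', pmap s y = Some y' ->
    (forall i, (y'.1 i)%:Z = (y.1 i)%:Z + x i) /\ y'.2 = y.2 - z.

Lemma translates_agree s t x z y : translates s x z -> translates t x z ->
  pmap s y -> pmap t y -> pmap s y = pmap t y.
Proof.
move=> sx tx; case Es : (pmap s y) => [[a c]|] // _.
case Et : (pmap t y) => [[b d]|] // _.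
have [/= h1 ->] := sx _ _ Es; have [/= h2 ->] := tx _ _ Et.
congr (Some (_, _)); apply/ffunP => i.
have : (a i)%:Z = (b i)%:Z by rewrite h1 h2.
by case.
Qed.

Lemma translatesM s t x z x' z' : translates s x z -> translates t x' z' ->
  translates (s ** t) (fun i => x i + x' i) (z + z').
Proof.
move=> sx tx y y'; rewrite pmapM; case E : (pmap s y) => [y1|] //= E'.
have [h1 ->] := tx _ _ E'; have [h2 ->] := sx _ _ E.
by split=> [i|]; rewrite ?h1 ?h2 ?opprD addrA.
Qed.

Lemma translates_star s x z : translates s x z ->
  translates (star s) (fun i => - x i) (- z).
Proof.
move=> sx y y' E; have /sx[h1 h2] : pmap s y' = Some y by apply/pmap_star.
by split=> [i|]; rewrite ?h1 ?h2 ?opprK ?addrK ?subrK.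
Qed.

(** Coordinates after [k] carry the identity operator, hence are not moved. *)
Definition shift_B (k : nat) (m n : multi l) (i : 'I_l) : int :=
  if (i <= k)%N then (n i)%:Z - (m i)%:Z else 0.

Lemma translates_B k r m n :
  translates (Bsg R k r m n) (shift_B k m n) (texp k r m n).
Proof.
move=> [y c] y'; rewrite pmap_B /bmap /=; case: ifP => // bd [<-] /=.
split=> // i; have := forallP bd i; rewrite ffunE /shift_B.
by case: (ltngtP i k) => //= h; lia.
Qed.

Lemma pdom_neq0 e : e <> pzero T -> exists y, pdom e y.
Proof.
move=> e0; apply: contrapT => /forallNP h; apply: e0.
by apply: pdom_inj => y; rewrite pdom0; exact/negbTE/negP/h.
Qed.

Lemma char_neq0 (chi : chars T) e : val chi e -> exists y, pdom e y.
Proof.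
move=> ce; apply: pdom_neq0 => e0.
by have [_ _] := charP chi; rewrite -e0 ce.
Qed.

(** A common restriction of [s] and [t] to a nonzero projection is a translation
    of a nonempty set, which has only one vector. Conversely, if the vectors
    agree then [s] and [t] coincide on the intersection of their domains, and
    the character takes the value 1 on its projection. *)
Lemma germ_eq_shift (p q : act_pairs T) x z x' z' :
  translates (val p).2 x z -> translates (val q).2 x' z' ->
  germ_eq p q <-> [/\ (val p).1 = (val q).1, x = x' & z = z'].
Proof.
move=> px qx; split=> [[pq [e [pe epq]]]|[pq xx zz]].
  have : val (val p).1 (pmul e (prange (val p).2)).
    by rewrite char_mul pe; exact: act_pairP.
  move=> /char_neq0[y]; rewrite pdomM pdom_prange => /andP[ey py].
  have : pmap (val e ** (val p).2) y = pmap (val e ** (val q).2) y by rewrite epq.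
  rewrite !pmapM pmap_proj ey /= => E.
  case F : (pmap (val p).2 y) py => [y'|] // _.
  have [h1 h2] := px _ _ F; rewrite F in E; have [h3 h4] := qx _ _ (esym E).
  split=> //; first by apply/funext => i; apply: (addrI (y.1 i)%:Z); rewrite -h1 -h3.
  by apply/oppr_inj/(addrI y.2); rewrite -h2 -h4.
rewrite -xx -zz in qx.
split=> //; exists (pmul (prange (val p).2) (prange (val q).2)).
split; first by rewrite char_mul act_pairP pq act_pairP.
apply: pmap_inj => y; rewrite !(pmapM (val (pmul _ _))) !pmap_proj pdomM !pdom_prange.
by case: ifP => //= /andP[sy ty]; exact: translates_agree px qx sy ty.
Qed.

(** The germ [g] has range [chi] and translation vector [(x, z)]. By the next
    two lemmas these data are well defined and determine [g]. *)
Definition germ_at (g : germ T) (chi : chars T) (x : 'I_l -> int) (z : int) :=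
  exists p : act_pairs T,
    [/\ g = \pi p, (val p).1 = chi & translates (val p).2 x z].

Lemma germ_at_uniq g chi chi' x x' z z' : germ_at g chi x z ->
  germ_at g chi' x' z' -> [/\ chi = chi', x = x' & z = z'].
Proof.
move=> [p [gp <- px]] [q [gq <- qx]].
have /eqP/germ_eqP : \pi_(germ T) p = \pi_(germ T) q by rewrite -gp -gq.
by move/(germ_eq_shift px qx).
Qed.

Lemma germ_at_inj g g' chi x z : germ_at g chi x z -> germ_at g' chi x z -> g = g'.
Proof.
move=> [p [-> pc px]] [q [-> qc qx]]; apply/eqP/germ_eqP/(germ_eq_shift px qx).
by rewrite pc qc.
Qed.

Lemma germ_at_pi (p : act_pairs T) x z :
  translates (val p).2 x z -> germ_at (\pi p) (val p).1 x z.
Proof. by move=> px; exists p. Qed.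

End PartialMaps.

(** * The characters phi(w) as limits *)

Lemma fin_rank_eq l (k k' : 'I_l -> option nat) :
  (forall i : 'I_l, (i <= fin_rank k)%N -> k i = None <-> k' i = None) ->
  fin_rank k = fin_rank k'.
Proof.
move=> kk; apply/val_inj => /=.
case: (ltngtP (fin_rank k) (fin_rank k')) => // h.
  have rl : (fin_rank k < l)%N by rewrite (leq_trans h)// -ltnS.
  have [] := @fin_rank_fin l k' (Ordinal rl) h.
  by apply/kk => //; exact: (@fin_rank_inf l k (Ordinal rl)).
have rl : (fin_rank k' < l)%N by rewrite (leq_trans h)// -ltnS.
have [] := @fin_rank_fin l k (Ordinal rl) h.
by apply/kk; [exact: ltnW|exact: (@fin_rank_inf l k' (Ordinal rl))].
Qed.

Section Limit.
Variables (R : realType) (l : nat).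
Local Notation T := (Tsg R l).
Local Notation X := (hidx l).
Local Notation Z := {ptws 'I_l -> zbar}.
Implicit Types (w : Z) (y : X).

(** The map $\phi$, as a map on the whole of $\overline{\mathbb Z}^\ell$: it takes
    absolute values of the finite coordinates, which is harmless on
    $\overline{\mathbb N}^\ell$ and avoids working on a subspace. *)
Definition Phi w : chars T := phi R (nat_part w).

(** Membership of a point of $\mathbb N^\ell$ in a basic neighbourhood of [w]. *)
Definition near_pt (N : nat) w y : Prop :=
  forall i : 'I_l, if w i is Some a then y.1 i = `|a|%N else (N <= y.1 i)%N.

Definition fill_in (N : nat) w : X :=
  ([ffun i : 'I_l => odflt N (nat_part w i)], 0).

Lemma fill_in_near N w : near_pt N w (fill_in N w).
Proof. by move=> i; rewrite /fill_in ffunE /nat_part; case: (w i). Qed.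

Lemma near_pt_fin N w y i a : nbar w -> near_pt N w y -> w i = Some a ->
  (y.1 i)%:Z = a.
Proof.
move=> nw yw E; have := yw i; rewrite E => ->.
by rewrite gez0_abs//; exact: nw E.
Qed.

Lemma near_ptW N N' w y : (N <= N')%N -> near_pt N' w y -> near_pt N w y.
Proof.
by move=> NN h i; have := h i; case: (w i) => // h'; exact: leq_trans h'.
Qed.

Lemma nat_part_some w i : nat_part w i <> None -> exists a, w i = Some a.
Proof. by rewrite /nat_part; case: (w i) => [a|] // _; exists a. Qed.

Lemma nat_part_none w i : nat_part w i = None -> w i = None.
Proof. by rewrite /nat_part; case: (w i). Qed.

(** It is enough that [N] exceeds all the coordinates defining the projection
    [e]. If [e] is supported on $y_1=m_1,\dots,y_{k-1}=m_{k-1},y_k\ge m_k$, a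
    point [y] that large where [w] is infinite can only be in the support when
    [w] is finite before [k]; the truth of the conditions then depends only on
    the coordinates of [w] up to the first infinite one. *)
Lemma Phi_lim w (e : projs T) : exists N, forall y, near_pt N w y ->
  val (Phi w) e = pdom e y.
Proof.
case: (proj_cases e) => [->|[k [m eE]]].
  by exists 0%N => y _; rewrite pdom0; have [_ _ ->] := charP (Phi w).
exists (\max_(i < l) m i).+1 => y yw.
have mN i : (m i < (\max_(i < l) m i).+1)%N by rewrite ltnS; exact: leq_bigmax.
set r := fin_rank (nat_part w).
have wfin (i : 'I_l) : (i < r)%N -> odflt 0%N (nat_part w i) = y.1 i.
  move=> ir; have [a E] := nat_part_some (fin_rank_fin ir).
  by have := yw i; rewrite /nat_part E /= => <-.
have winf (i : 'I_l) : i = r :> nat -> (m i < y.1 i)%N.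
  move=> ir; have := yw i; rewrite (nat_part_none (fin_rank_inf ir)).
  exact/leq_trans/mN.
apply/asboolP/idP => [[n /pdom_le h]|].
  (* y, raised at the first infinite position so as to lie below the filter's
     generator *)
  pose y' : X :=
    ([ffun i : 'I_l => if i == r :> nat then maxn (y.1 i) (n i) else y.1 i], 0).
  have : pdom e y'.
    apply: h; rewrite pdom_pB; apply/forallP => i; rewrite !ffunE -/r.
    case: (ltngtP i r) => ir //=; first by rewrite (wfin i ir).
    exact: leq_maxr.
  rewrite !eE => /forallP bd; apply/forallP => i; have := bd i; rewrite ffunE.
  case: (i =P r :> nat) => // ir; move: (winf i ir) => my.
  case: (i < k)%N => [/eqP E|_]; last by apply/implyP => _; exact: ltnW.
  by have := leq_maxl (y.1 i) (n i); rewrite E leqNgt my.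
rewrite eE => /forallP bd; exists m; apply/pdom_le => y'; rewrite pdom_pB eE -/r.
move=> /forallP bd'; apply/forallP => i; have := bd i; have := bd' i.
rewrite !ffunE -/r.
have kr : (k <= r)%N.
  rewrite leqNgt; apply/negP => rk.
  have rl : (r < l)%N by rewrite (leq_trans rk)// -ltnS.
  have := bd (Ordinal rl); have := winf (Ordinal rl) erefl; rewrite /= rk.
  by move=> + /eqP E; rewrite E ltnn.
case: (ltngtP i k) => ik //=.
  have ir : (i < r)%N by apply: leq_trans kr.
  by rewrite ir; rewrite (wfin i ir) => /eqP ->.
case: (ltngtP i r) => ir //=.
  by rewrite (wfin i ir) => /eqP ->.
by move: kr; rewrite -ik leqNgt ir.
Qed.

(** A point close enough to [w'] is close to [w], so both characters are read off
    at the same point. *)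
Lemma Phi_locally_cst w (e : projs T) : exists N : nat, forall w' : Z,
  (forall i, if w i is Some a then w' i = Some a
     else if w' i is Some a then N%:Z <= a else True) ->
  val (Phi w') e = val (Phi w) e.
Proof.
have [N hN] := Phi_lim w e; exists N => w' h.
have [N' hN'] := Phi_lim w' e.
have f := @fill_in_near (maxn N N') w'.
rewrite (hN' (fill_in (maxn N N') w')); last exact: near_ptW (leq_maxr _ _) f.
apply/esym/hN => i; have := h i; have := f i.
case: (w i) => [a|] fi; first by move=> E; rewrite E in fi.
by case: (w' i) fi; [move=> a ->; lia|move=> + _; apply: leq_trans; exact: leq_maxl].
Qed.

Lemma chars_ext (chi chi' : chars T) :
  (forall e, val chi e = val chi' e) -> chi = chi'.
Proof. by move=> h; apply/val_inj/funext. Qed.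

(** If [y] is close to [w], then its translate by [x] is close to the translate
    of [w]; on points, [pdom_conj] is the desired equivariance. *)
Lemma Phi_act w s x z (h : char_dom s (Phi w)) :
  nbar w -> nbar (zbar_translate w x) -> translates s x z ->
  act (act_pair h) = Phi (zbar_translate w x).
Proof.
move=> nw nwx sx; apply: chars_ext => e.
have [N1 h1] := Phi_lim w (pconj s e).
have [N2 h2] := Phi_lim (zbar_translate w x) e.
have [N3 h3] := Phi_lim w (prange s).
(* translating by x moves coordinates by at most b, so points that are N2 + b
   close to w are moved to points N2 close to its translate *)
pose b := \sum_(i < l) `|x i|%N.
have xb i : (`|x i| <= b)%N by rewrite /b (bigD1 i) //= leq_addr.
pose N := (N1 + (N2 + b) + N3)%N.
have f := @fill_in_near N w; set y := fill_in N w in f.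
have f1 : near_pt N1 w y by apply: near_ptW f; rewrite /N; lia.
have f3 : near_pt N3 w y by apply: near_ptW f; rewrite /N; lia.
transitivity (val (Phi w) (pconj s e)) => //; rewrite (h1 _ f1) pdom_conj.
have : val (Phi w) (prange s) := h; rewrite (h3 _ f3) pdom_prange.
case E : (pmap s y) => [y'|] // _.
have [Ex _] := sx _ _ E; apply/esym/h2 => i.
have := f i; have := Ex i; have := xb i; rewrite /zbar_translate.
case wi : (w i) => [a|] /=; rewrite /N; last by lia.
by rewrite (near_pt_fin nw f wi); lia.
Qed.

(** Points close to [w] are in the domain of [s], and agree with [w] at its finite
    coordinates; their images have nonnegative coordinates. *)
Lemma nbar_translate w s x z : nbar w -> char_dom s (Phi w) ->
  translates s x z -> nbar (zbar_translate w x).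
Proof.
move=> nw h sx; have [N hN] := Phi_lim w (prange s).
have f := @fill_in_near N w; set y := fill_in N w in f.
have : val (Phi w) (prange s) := h; rewrite (hN _ f) pdom_prange.
case E : (pmap s y) => [y'|] // _ i a; have [Ex _] := sx _ _ E.
rewrite /zbar_translate; case wi : (w i) => [b|] //= [<-].
by rewrite -(near_pt_fin nw f wi) -Ex.
Qed.

(** An element $B_k(r,m,n)$ has $\phi(w)$ in its domain only if the coordinates of
    [w] before [k] are finite. So an infinite coordinate of [w] can only occur
    at [k] or later. After it nothing is moved, and, as $k\le\ell$ in that case,
    the exponent of $t$ is minus the total displacement. *)
Lemma domain_Sigma_ex w s : nbar w -> char_dom s (Phi w) ->
  exists x z, translates s x z /\ Sigma l (z, (x, w)).
Proof.
move=> nw h; have [s0|[k [r [m [n sE]]]]] := Tsg_cases s.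
  by have [y] := char_neq0 h; rewrite pdom_prange s0 pmap_zero.
have sx : translates s (shift_B k m n) (texp k r m n) by rewrite sE; exact: translates_B.
exists (shift_B k m n), (texp k r m n); split=> //; split.
  by split=> //; exact: nbar_translate h sx.
rewrite /am_w /am_x /am_z /= => i wi.
have ki : (k <= i)%N.
  rewrite leqNgt; apply/negP => ik.
  (* otherwise, a point close to w can be chosen with i-th coordinate > m i *)
  have [N hN] := Phi_lim w (prange s).
  have f := @fill_in_near (maxn N (m i).+1) w.
  have : val (Phi w) (prange s) := h.
  rewrite (hN (fill_in (maxn N (m i).+1) w)); last first.
    exact: near_ptW (leq_maxl _ _) f.
  rewrite sE pdom_range => /forallP /(_ i); rewrite ik => /eqP E.
  by have := f i; rewrite wi E geq_max ltnn andbF.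
split=> [j ij|]; first by rewrite /shift_B leqNgt (leq_ltn_trans ki ij).
rewrite /texp ltn_eqF ?(leq_ltn_trans ki)// add0r -sumrN.
rewrite [LHS]big_mkcond [RHS]big_mkcond; apply: eq_bigr => j _; rewrite /shift_B.
case: (leqP j k) => jk; last by case: ifP; rewrite // oppr0.
by rewrite (leq_trans jk ki) opprB.
Qed.

(** The canonical representative: everything after the first infinite coordinate
    is replaced by infinity. *)
Definition trunc w : Z :=
  fun i => if (i < fin_rank (nat_part w))%N then w i else None.

(** If $\phi(u)=\phi(v)$, then the supports of the projections generating the
    filter of $\phi(u)$ contain points arbitrarily close to [v]. Those points
    have the coordinates of [u] before the first infinite one, and arbitrarily
    large ones there. *)
Lemma Phi_inj w w' : nbar w -> nbar w' -> Phi w = Phi w' -> trunc w = trunc w'.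
Proof.
suff H u v (i : 'I_l) : nbar u -> nbar v -> Phi u = Phi v ->
    (i <= fin_rank (nat_part u))%N -> v i = u i.
  move=> nw nw' E.
  have rr : fin_rank (nat_part w) = fin_rank (nat_part w').
    by apply: fin_rank_eq => i ir; rewrite /nat_part (H w w').
  apply/funext => i; rewrite /trunc -rr; case: ifP => // ir.
  by rewrite (H w w')// ltnW.
move=> nu nv E ir; set r := fin_rank (nat_part u) in ir *.
have test n N : exists y, near_pt N v y /\ bdom r (proj_cat r (nat_part u) n) y.1.
  have ue : val (Phi u) (pB R r (proj_cat r (nat_part u) n)).
    by apply/asboolP; exists n; exact: pmulee.
  rewrite E in ue; have [N' hN'] := Phi_lim v (pB R r (proj_cat r (nat_part u) n)).
  have f := @fill_in_near (maxn N N') v.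
  exists (fill_in (maxn N N') v); split; first exact: near_ptW (leq_maxl _ _) f.
  rewrite -(pdom_pB R) -(hN' (fill_in (maxn N N') v))//.
  exact: near_ptW (leq_maxr _ _) f.
move: ir; rewrite leq_eqVlt => /orP[/eqP ir|ir].
  rewrite (nat_part_none (fin_rank_inf ir)); case Ev : (v i) => [a|] //.
  (* a generator whose coordinate at r exceeds the supposed finite value a *)
  have [y [yv /forallP/(_ i)]] := test [ffun=> `|a|.+1%N] 0%N.
  rewrite !ffunE ir ltnn eqxx /=; have := yv i; rewrite Ev => ->.
  by rewrite ltnn.
have [a Eu] := nat_part_some (fin_rank_fin ir); have a0 := nu _ _ Eu.
(* if v were infinite at i, nearby points could exceed the value a of u *)
have [y [yv /forallP/(_ i)]] := test [ffun=> 0%N] `|a|.+1%N.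
rewrite !ffunE ir /nat_part Eu /= => /eqP ya; have := yv i; rewrite ya.
case Ev : (v i) => [b|]; last by rewrite ltnn.
by rewrite -(near_pt_fin nv yv Ev) ya gez0_abs.
Qed.

Lemma phi_eq_upto_infinite (k k' : 'I_l -> option nat) :
  (forall i : 'I_l, (forall j : 'I_l, (j < i)%N -> k j <> None) -> k i = k' i) ->
  phi R k = phi R k'.
Proof.
move=> h.
have kk (i : 'I_l) : (i <= fin_rank k)%N -> k i = k' i.
  move=> ir; apply: h => j ji; apply: fin_rank_fin.
  exact: leq_trans ji ir.
have rr : fin_rank k = fin_rank k' by apply: fin_rank_eq => i /kk ->.
have pc n : proj_cat (fin_rank k) k n = proj_cat (fin_rank k') k' n.
  apply/ffunP => i; rewrite !ffunE -rr; case: ifP => // ir.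
  by rewrite kk// ltnW.
have F : phi_filter (R := R) k = phi_filter (R := R) k'.
  by apply/funext => f; rewrite /phi_filter /mkset; under eq_exists do rewrite pc rr.
apply: chars_ext => e; change (`[< phi_filter k e >] = `[< phi_filter k' e >]).
by rewrite F.
Qed.

End Limit.

(** * Compactness and tight characters *)

Section Topology.
Variables (R : realType) (l : nat).
Local Notation T := (Tsg R l).
Local Notation X := (hidx l).
Local Notation Z := {ptws 'I_l -> zbar}.
Implicit Types (w : Z) (y : X).

Lemma nbhs_ptws_forall (V : topologicalType) (I : finType) (f : {ptws I -> V})
    (A : I -> set V) :
  (forall i, nbhs (f i) (A i)) -> nbhs f [set g : {ptws I -> V} | forall i, A i (g i)].
Proof.
move=> fA.
suff h i : nbhs f (@proj _ (fun=> V) i @^-1` A i).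
  exact: (@filter_forall {ptws I -> V} I _ (nbhs f) _ h).
by apply: (@proj_continuous _ (fun=> V) i f); exact: fA.
Qed.

Lemma zbar_nbhsE (w : zbar) (A : set zbar) : nbhs w A = zbar_nbhs w A.
Proof. by []. Qed.

(** A filter that does not cluster at infinity contains a set of bounded
    nonnegative integers, which is finite. *)
Lemma compact_zbar_nonneg : compact [set a : zbar | forall n, a = Some n -> 0 <= n].
Proof.
move=> F FF FK; apply: contrapT => noc.
have : ~ cluster F (None : zbar).
  by move=> c; case: noc; exists (None : zbar).
move=> /existsNP[A /existsNP[B /not_implyP[FA /not_implyP[]]]].
rewrite zbar_nbhsE => -[B0 [N BN]] AB.
pose G : set zbar := [set a | exists2 n : nat, (n <= `|N|)%N & a = Some n%:Z].
have FG : F G.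
  apply: filterS (filterI FA FK) => -[a|] [Aa /= Ka].
    exists `|a|%N; last by rewrite gez0_abs// Ka.
    rewrite leqNgt; apply/negP => h; apply: AB; exists (Some a); split=> //.
    by apply: BN; have := Ka _ erefl; lia.
  by exfalso; apply: AB; exists None.
have Gfin : finite_set G.
  apply: (@sub_finite_set _ _ ((fun n : nat => Some n%:Z : zbar) @` `I_(`|N|.+1))).
    by move=> a [n nN ->]; exists n.
  exact/finite_image/finite_II.
have [a [[n _ an] ca]] := finite_compact Gfin FF FG.
by case: noc; exists a; split=> // m; rewrite an => -[<-].
Qed.

Lemma compact_nbar : compact [set w : Z | nbar w].
Proof.
have := @tychonoff _ (fun _ : 'I_l => zbar) _ (fun=> compact_zbar_nonneg).
by congr compact.
Qed.

Lemma ptws_continuous (S V : topologicalType) (I : Type) (f : S -> {ptws I -> V}) :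
  (forall i, continuous (fun x => f x i)) -> continuous f.
Proof.
move=> fi x; have FF : Filter (f @ x) by exact: fmap_filter.
apply/cvg_sup => i A [B [[C oC CB] Bx BA]]; apply: filterS BA _.
rewrite -CB; apply: (fi i x C); apply: open_nbhs_nbhs; split=> //.
by rewrite -CB in Bx.
Qed.

Lemma Phi_continuous : continuous (@Phi R l : Z -> chars T).
Proof.
apply/continuous_comp_initial/ptws_continuous => e w A /nbhs_singleton /= Aw.
have [N hN] := Phi_locally_cst w e.
pose B i : set zbar := if w i is Some a then [set Some a] else
  fun b : zbar => if b is Some a then N%:Z <= a else True.
have : nbhs w [set w' : Z | forall i, B i (w' i)].
  apply: (@nbhs_ptws_forall zbar _ w B) => i; rewrite zbar_nbhsE /B.
  case: (w i) => [a|] /=; first exact/principal_filterP.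
  by split=> //; exists N%:Z.
apply: filterS => w' h.
suff E : val (Phi R w') e = val (Phi R w) e by change (A (val (Phi R w') e)); rewrite E.
by apply: hN => i; have := h i; rewrite /B; case: (w i).
Qed.

Lemma closed_char (e : projs T) : closed [set x : chars T | val x e].
Proof.
have -> : [set x : chars T | val x e] = ~` [set x : chars T | val x e = false].
  by apply/seteqP; split=> x /=; case: (val x e).
apply: open_closedC; exists (proj e @^-1` [set false]); last by apply/seteqP; split.
by apply: open_comp; [move=> x _; exact: proj_continuous|exact: discrete_open].
Qed.

Lemma chars_hausdorff : hausdorff_space (chars T).
Proof.
move=> x y c; apply: chars_ext => e.
have cl (z1 z2 : chars T) : cluster (nbhs z1) z2 -> val z1 e -> val z2 e.
  move=> c12 z1e; apply: contrapT => z2e.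
  have o1 : nbhs z1 [set x : chars T | val x e].
    by apply: open_nbhs_nbhs; split=> //; exact: open_char.
  have o2 : nbhs z2 (~` [set x : chars T | val x e]).
    by apply: open_nbhs_nbhs; split=> //; exact/closed_openC/closed_char.
  by have [z [? ]] := c12 _ _ o1 o2.
apply/idP/idP; first exact: cl.
by apply: cl => A B Ax By; rewrite setIC; exact: c.
Qed.

Lemma Phi_separates_pzero (e : projs T) :
  e <> pzero T -> exists2 w : Z, nbar w & val (Phi R w) e.
Proof.
move=> /pdom_neq0[y ye].
pose w : Z := fun i => Some (y.1 i)%:Z.
exists w; first by move=> i a [<-].
by have [N hN] := Phi_lim w e; rewrite (hN y).
Qed.

(** For [e] in the ultrafilter, the sets of those [w] with $\phi(w)(e)=1$ are
    closed, nonempty and stable under intersection. At a common point [w], the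
    filter of $\phi(w)$ contains the given one, so equals it by maximality. *)
Lemma ultrafilter_Phi (chi : chars T) : chars_infty T chi ->
  exists2 w : Z, nbar w & chi = Phi R w.
Proof.
move=> [Fchi chimax].
pose K (e : projs T) : set Z := [set w | nbar w /\ val (Phi R w) e].
have [[e0 ce0] chi0 chiM _] := Fchi.
have PF : ProperFilter (filter_from (char_filter chi) K).
  apply: filter_from_proper => [|e ce].
    apply: filter_from_filter; first by exists e0.
    move=> e f ce cf; exists (pmul e f); first exact: chiM.
    by move=> w [nw]; rewrite char_mul => /andP[].
  have [|w nw we] := @Phi_separates_pzero e; last by exists w.
  by move=> e_0; rewrite e_0 in ce.
have [|w [nw cw]] := compact_nbar PF; first by exists e0 => // w [].
have chiw : char_filter chi `<=` char_filter (Phi R w).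
  move=> e ce; have : closed (@Phi R l @^-1` [set x : chars T | val x e] : set Z).
    by move/continuous_closedP : Phi_continuous; apply; exact: closed_char.
  have FK : filter_from (char_filter chi) K (K e) by exists e.
  by apply=> B wB; have [v [[_ ve] Bv]] := cw _ _ FK wB; exists v.
exists w => //; apply: chars_ext => e; apply/idP/idP; first exact: chiw.
by apply: chimax chiw e; exact: char_filterP.
Qed.

Lemma tight_Phi (chi : chars T) : chars_tight T chi ->
  exists2 w : Z, nbar w & chi = Phi R w.
Proof.
have cK : compact (@Phi R l @` [set w : Z | nbar w]).
  apply: continuous_compact compact_nbar.
  exact/continuous_subspaceT/Phi_continuous.
move=> t; have : closure (@Phi R l @` [set w : Z | nbar w]) chi.
  by apply: closureS t => x /ultrafilter_Phi[w nw ->]; exists w.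
move=> /(compact_closed chars_hausdorff cK)[w nw <-].
by exists w.
Qed.

End Topology.

(** * Germs of Sheu's groupoid *)

Lemma prangeM (S : invSemigroup0) (s t : S) :
  prange (s ** t) = pconj s (prange t).
Proof. by apply/val_inj; rewrite /= starM !smulA. Qed.

Lemma pconj_prange_star (S : invSemigroup0) (s : S) :
  pconj s (prange (star s)) = prange s.
Proof. by rewrite -[RHS]pconj_source; congr pconj; apply/val_inj; rewrite /= sstarK. Qed.

Section Psi.
Variables (R : realType) (l : nat).
Local Notation T := (Tsg R l).
Local Notation Z := {ptws 'I_l -> zbar}.
Implicit Types (w : Z) (g h k : Sigma l).

Lemma SigmaP g : Sigma l (val g).
Proof. by have /set_mem := valP g. Qed.

Lemma Sigma_nbar g : nbar (am_w (val g)).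
Proof. by have [[]] := SigmaP g. Qed.

Lemma Sigma_nbar_source g : nbar (am_source (val g)).
Proof. by have [[]] := SigmaP g. Qed.

(** If all coordinates of [w] are finite, the term [psi_a] contributes the
    displacement that the exponent subtracts again, leaving [z]. Otherwise the
    condition defining [Sigma] at the first infinite coordinate says that [z] is
    minus the displacement, and that later coordinates are not moved. *)
Lemma psi_translates g :
  translates (psi_B R (val g)) (am_x (val g)) (am_z (val g)).
Proof.
set r := psi_rank (val g).
have rinf (i : 'I_l) : i = r :> nat -> am_w (val g) i = None.
  by move=> ir; apply: nat_part_none; apply: fin_rank_inf.
have xE : shift_B r (psi_m (val g)) (psi_n (val g)) = am_x (val g).
  apply/funext => i; rewrite /shift_B !ffunE -/r.
  case: (ltngtP i r) => ir /=.
  - have [a Ea] := nat_part_some (fin_rank_fin ir).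
    have a0 := Sigma_nbar Ea.
    have := @Sigma_nbar_source g i; rewrite /am_source /zbar_translate /nat_part Ea /=.
    by move=> /(_ _ erefl); lia.
  - have rl : (r < l)%N by rewrite (ltn_trans ir).
    have [_ /(_ (Ordinal rl) (rinf (Ordinal rl) erefl))[x0 _]] := SigmaP g.
    by rewrite x0.
  - by lia.
have := @translates_B R l r (psi_a (val g)) (psi_m (val g)) (psi_n (val g)).
rewrite xE; suff -> : texp r (psi_a (val g)) (psi_m (val g)) (psi_n (val g)) =
  am_z (val g) by [].
(* the coordinates of psi_n - psi_m are those of x, up to position r *)
have -> : texp r (psi_a (val g)) (psi_m (val g)) (psi_n (val g)) =
    (if r == l :> nat then psi_a (val g) else 0) -
    \sum_(i < l | (i <= r)%N) am_x (val g) i.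
  rewrite /texp -sumrN; congr (_ + _); apply: eq_bigr => i ir.
  by rewrite -xE /shift_B ir opprB.
case: eqP => rl; last first.
  have {}rl : (r < l)%N by have := ltn_ord r; lia.
  have [_ /(_ (Ordinal rl) (rinf (Ordinal rl) erefl))[_ ->]] := SigmaP g.
  by rewrite add0r.
rewrite /psi_a -/r.
suff -> : \sum_(i < l | (i <= r)%N) am_x (val g) i =
  \sum_(i < l | (i < r)%N) am_x (val g) i by rewrite addrK.
by apply: eq_bigl => i; rewrite rl ltn_ord ltnW.
Qed.

Arguments psi_translates : clear implicits.

Lemma psi_at g :
  germ_at (val (psi R g)) (Phi R (am_w (val g))) (am_x (val g)) (am_z (val g)).
Proof. by exists (psi_pair R (val g)); split=> //; exact: psi_translates. Qed.

Lemma ambient_ext (a b : ambient l) :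
  am_z a = am_z b -> am_x a = am_x b -> am_w a = am_w b -> a = b.
Proof.
by case: a => [? [? ?]]; case: b => [? [? ?]]; rewrite /am_z /am_x /am_w /= => -> -> ->.
Qed.

Lemma psi_eqP g h : psi R g = psi R h <->
  [/\ Phi R (am_w (val g)) = Phi R (am_w (val h)),
      am_x (val g) = am_x (val h) & am_z (val g) = am_z (val h)].
Proof.
split=> [gh|[ww xx zz]].
  have := psi_at g; rewrite gh => gx.
  exact: germ_at_uniq gx (psi_at h).
apply/val_inj/(germ_at_inj (psi_at g)).
by rewrite ww xx zz; exact: psi_at.
Qed.

Lemma trunc_cases w (i : 'I_l) : trunc w i = None \/ trunc w i = w i.
Proof. by rewrite /trunc; case: ifP; [right|left]. Qed.

Lemma trunc_nbar w : nbar w -> nbar (trunc w).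
Proof. by move=> nw i a; case: (trunc_cases w i) => -> //; exact: nw. Qed.

Lemma trunc_translate w x : trunc (zbar_translate w x) = zbar_translate (trunc w) x.
Proof.
have rr : fin_rank (nat_part w) = fin_rank (nat_part (zbar_translate w x)).
  apply: fin_rank_eq => i _; rewrite /nat_part /zbar_translate.
  by case: (w i).
by apply/funext => i; rewrite /trunc /zbar_translate -rr; case: ifP.
Qed.

(** Truncation makes more coordinates infinite, but only after the first infinite
    one, whose condition already implies those of all later coordinates. *)
Lemma Sigma_trunc (a : ambient l) : Sigma l a ->
  Sigma l (am_z a, (am_x a, trunc (am_w a))).
Proof.
move=> [[nr ns] sa]; split.
  split; first exact: trunc_nbar.
  rewrite /am_source /am_w /am_x /= -trunc_translate; exact: trunc_nbar.
rewrite /am_w /am_x /am_z /= => i ti.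
set r := fin_rank (nat_part (am_w a)).
have ri : (r <= i)%N.
  rewrite leqNgt; apply/negP => ir.
  have [b Eb] := nat_part_some (fin_rank_fin ir).
  by move: ti; rewrite -/(am_w a) /trunc ir Eb.
have rl : (r < l)%N by exact: leq_ltn_trans (ltn_ord i).
have [x0 zE] := sa (Ordinal rl) (nat_part_none (@fin_rank_inf l _ (Ordinal rl) erefl)).
split=> [j ij|]; first by apply: x0; exact: leq_ltn_trans ij.
rewrite -[LHS]/(am_z a) zE; congr (- _); rewrite [LHS]big_mkcond [RHS]big_mkcond.
apply: eq_bigr => j _ /=; case: (leqP j r) => jr; first by rewrite (leq_trans jr ri).
by case: ifP => // _; rewrite -[RHS]/(am_x a j) x0.
Qed.

Definition Sigma_truncate g : Sigma l :=
  exist _ (am_z (val g), (am_x (val g), trunc (am_w (val g))))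
    (mem_set (Sigma_trunc (SigmaP g))).

Lemma sheu_eq_truncate g : sheu_eq g (Sigma_truncate g).
Proof.
set r := fin_rank (nat_part (am_w (val g))).
have [rl|rl] := ltnP r l.
  apply: rst_step; exists (Ordinal rl); split.
    exact: (nat_part_none (@fin_rank_inf l _ (Ordinal rl) erefl)).
  rewrite /=; congr (_, (_, _)); apply/funext => i; rewrite /trunc -/r.
  case: (ltngtP i r) => // ir.
  by have /nat_part_none -> := @fin_rank_inf l (nat_part (am_w (val g))) i ir.
suff -> : Sigma_truncate g = g by exact: rst_refl.
apply/val_inj/ambient_ext => //; apply/funext => i.
by rewrite /am_w /= /trunc -/r (leq_trans (ltn_ord i) rl).
Qed.

Lemma sheu_eq_psi g h : sheu_eq g h -> psi R g = psi R h.
Proof.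
elim=> {g h} [g h [i [gi gh]]|g|g h _ ->|g h k _ -> _ ->] //.
apply/psi_eqP; rewrite gh; split=> //; apply: phi_eq_upto_infinite => j jfin.
rewrite /nat_part /am_w /=; case: leqP => // /jfin[].
by rewrite /nat_part gi.
Qed.

Lemma Sigma_truncate_eq g h : psi R g = psi R h ->
  Sigma_truncate g = Sigma_truncate h.
Proof.
move=> /psi_eqP[ww xx zz]; apply/val_inj/ambient_ext => //=.
exact: Phi_inj (@Sigma_nbar g) (@Sigma_nbar h) ww.
Qed.

(** Equal images force equal truncations, and every element is equivalent to its
    truncation. *)
Lemma psi_sheu_eq g h : psi R g = psi R h -> sheu_eq g h.
Proof.
move=> /Sigma_truncate_eq E; apply: rst_trans (sheu_eq_truncate g) _.
by rewrite E; apply: rst_sym; exact: sheu_eq_truncate.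
Qed.

Lemma sheu_classP g h : sheu_class g = sheu_class h <-> sheu_eq g h.
Proof.
split=> [gh|gh].
  have : \pi_({eq_quot sheu_rel l}) g = \pi_({eq_quot sheu_rel l}) h := gh.
  by move=> /eqmodP /asboolP.
by apply: (_ : \pi_({eq_quot sheu_rel l}) g = \pi_({eq_quot sheu_rel l}) h);
   apply/eqmodP/asboolP.
Qed.

Lemma translates_uniq (s : T) chi x z x' z' : char_dom s chi ->
  translates s x z -> translates s x' z' -> x = x' /\ z = z'.
Proof.
move=> h sx sx'; have [_ -> ->] : [/\ chi = chi, x = x' & z = z']; last by [].
exact: germ_at_uniq (germ_at_pi (p := act_pair h) sx) (germ_at_pi (p := act_pair h) sx').
Qed.

Lemma domain_Sigma w (s : T) x z : nbar w -> char_dom s (Phi R w) -> translates s x z ->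
  Sigma l (z, (x, w)).
Proof.
move=> nw ws sx; have [x' [z' [sx' S]]] := domain_Sigma_ex nw ws.
by have [-> ->] := translates_uniq ws sx sx'.
Qed.

(** The tight range of a germ is some $\phi(w)$ by [tight_Phi], and then the
    translation vector of the germ together with [w] is in [Sigma]. *)
Lemma psi_surj (gam : tight_groupoid T) : exists g, psi R g = gam.
Proof.
have /set_mem [p [gp tp _]] := valP gam.
have [w nw pw] := tight_Phi tp.
have dp : char_dom (val p).2 (Phi R w) by rewrite -pw; exact: act_pairP.
have [x [z [sx S]]] := domain_Sigma_ex nw dp.
exists (exist _ (z, (x, w)) (mem_set S)); apply/val_inj.
apply: germ_at_inj (psi_at _) _; rewrite gp.
by exists p.
Qed.

Lemma act_Phi (p : act_pairs T) w x z : (val p).1 = Phi R w ->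
  nbar w -> nbar (zbar_translate w x) -> translates (val p).2 x z ->
  act p = Phi R (zbar_translate w x).
Proof.
move=> pw nw nwx px.
have dp : char_dom (val p).2 (Phi R w) by rewrite -pw; exact: act_pairP.
rewrite -(Phi_act dp nw nwx px); congr act; apply/val_inj.
by rewrite [LHS]surjective_pairing pw.
Qed.

(** Unlike [germ_at], which speaks of one representative of a germ, this gives
    vectors to all of them, as needed for [germ_at_rep]. *)
Lemma translates_ex (s : T) : exists x z, translates s x z.
Proof.
have [->|[k [r [m [n ->]]]]] := Tsg_cases s.
  by exists (fun=> 0), 0 => y y'; rewrite pmap_zero.
by exists (shift_B k m n), (texp k r m n); exact: translates_B.
Qed.

Lemma germ_at_rep (p : act_pairs T) chi x z : germ_at (\pi p) chi x z ->
  (val p).1 = chi /\ translates (val p).2 x z.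
Proof.
have [x' [z' px]] := translates_ex (val p).2.
by move=> /(germ_at_uniq (germ_at_pi px))[<- <- <-].
Qed.

Lemma act_psi g (p : act_pairs T) : val (psi R g) = \pi p ->
  [/\ (val p).1 = Phi R (am_w (val g)),
      translates (val p).2 (am_x (val g)) (am_z (val g))
    & act p = Phi R (am_source (val g))].
Proof.
move=> gp; have [pg px] : (val p).1 = Phi R (am_w (val g)) /\
    translates (val p).2 (am_x (val g)) (am_z (val g)).
  by apply: germ_at_rep; rewrite -gp; exact: psi_at.
split=> //.
exact: act_Phi pg (@Sigma_nbar g) (@Sigma_nbar_source g) px.
Qed.

Lemma psi_pairE g : val (psi R g) = \pi_(germ T) (psi_pair R (val g)).
Proof. by []. Qed.

(** The product is computed on representatives: the composite of translations by
    [x] and [x'] is a translation by their sum, and [Phi_act] identifies the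
    source of the first germ. *)
Lemma germ_mul_psi g h k : germ_mul (val (psi R g)) (val (psi R h)) (val (psi R k)) <->
  [/\ Phi R (am_w (val h)) = Phi R (am_source (val g)),
      Phi R (am_w (val k)) = Phi R (am_w (val g)),
      am_x (val k) = (fun i => am_x (val g) i + am_x (val h) i)
    & am_z (val k) = am_z (val g) + am_z (val h)].
Proof.
split=> [[p [q [u [[gp hq ku] [qp up us]]]]]|[hw kw kx kz]].
  have [pg px pa] := act_psi gp; have [qh qx _] := act_psi hq.
  have [uk ux _] := act_psi ku; have ux' := translatesM px qx.
  rewrite -us in ux'.
  have [kx kz] := translates_uniq (act_pairP u) ux ux'.
  by rewrite -qh -uk -pa -pg; split.
set p := psi_pair R (val g); set q := psi_pair R (val h).
have [_ px pa] := act_psi (psi_pairE g).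
have qp : (val q).1 = act p by rewrite pa -hw.
have du : char_dom ((val p).2 ** (val q).2) (val p).1.
  by have := act_pairP q; rewrite qp /char_dom /mkset prangeM.
exists p, q, (act_pair du); split; split=> //.
apply: (germ_at_inj (psi_at k)); rewrite kw kx kz.
by exists (act_pair du); split=> //; exact: translatesM px (psi_translates h).
Qed.

Lemma germ_inv_psi g h : germ_inv (val (psi R g)) (val (psi R h)) <->
  [/\ Phi R (am_w (val h)) = Phi R (am_source (val g)),
      am_x (val h) = (fun i => - am_x (val g) i)
    & am_z (val h) = - am_z (val g)].
Proof.
split=> [[p [q [gp hq qp qs]]]|[hw hx hz]].
  have [pg px pa] := act_psi gp; have [qh qx _] := act_psi hq.
  have qx' := translates_star px; rewrite -qs in qx'.
  have [hx hz] := translates_uniq (act_pairP q) qx qx'.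
  by rewrite -qh -pa; split.
set p := psi_pair R (val g).
have [_ px pa] := act_psi (psi_pairE g).
have dq : char_dom (star (val p).2) (act p).
  by have := act_pairP p; rewrite -pconj_prange_star.
exists p, (act_pair dq); split=> //.
apply: (germ_at_inj (psi_at h)); rewrite hw -pa hx hz.
by exists (act_pair dq); split=> //; exact: translates_star px.
Qed.

(** * Comparison of the topologies *)

Lemma val_Sigma_continuous : continuous (val : Sigma l -> ambient l).
Proof. exact: initial_continuous. Qed.

Lemma am_z_continuous : continuous (fun g => am_z (val g)).
Proof.
move=> g; apply: continuous_comp (@val_Sigma_continuous g) _; exact: cvg_fst.
Qed.

Lemma am_x_continuous : continuous (fun g => am_x (val g) : {ptws 'I_l -> int}).
Proof.
move=> g; apply: continuous_comp (@val_Sigma_continuous g) _.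
by apply: continuous_comp; [exact: cvg_snd|exact: cvg_fst].
Qed.

Lemma am_w_continuous : continuous (fun g => am_w (val g) : Z).
Proof.
move=> g; apply: continuous_comp (@val_Sigma_continuous g) _.
by apply: continuous_comp; exact: cvg_snd.
Qed.

Lemma near_same_shift g : \forall h \near g,
  am_x (val h) = am_x (val g) /\ am_z (val h) = am_z (val g).
Proof.
have hz : nbhs g [set h | am_z (val h) = am_z (val g)].
  by apply: (@am_z_continuous g [set am_z (val g)]); exact/principal_filterP.
have hx : nbhs g [set h | forall i, am_x (val h) i = am_x (val g) i].
  apply: (@am_x_continuous g
    [set f : {ptws 'I_l -> int} | forall i, f i = am_x (val g) i]).
  apply: (@nbhs_ptws_forall int _ _ (fun i => [set am_x (val g) i] : set int)) => i.
  exact/principal_filterP.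
by apply: filterS (filterI hx hz) => h [/funext].
Qed.

(** If [theta s V] contains the germ of [g], then [s] has the vector of [g]. Near
    [g] the vector is constant, and the range stays in [V] because $\phi$ is
    continuous; so the germs there are still germs of [s]. *)
Lemma psi_continuous : continuous (@psi R l).
Proof.
apply: continuous_comp_initial => g A.
rewrite nbhsE => -[B [oB Bg] BA].
suff : nbhs g [set h | B (val (psi R h))] by apply: filterS => h; exact: BA.
have [s [V [oV Vs [p [gp ps Vp]] VB]]] := oB _ Bg.
have [pg px _] := act_psi gp.
have wV : nbhs g [set h | V (Phi R (am_w (val h)))].
  apply: (@am_w_continuous g (@Phi R l @^-1` V)); apply: Phi_continuous.
  by apply: open_nbhs_nbhs; split=> //; rewrite -pg.
apply: filterS (filterI wV (near_same_shift g)) => h [Vh [hx hz]]; apply: VB.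
exists (act_pair (Vs _ Vh)); split=> //.
apply: (germ_at_inj (psi_at h)); exists (act_pair (Vs _ Vh)); split=> //.
by rewrite /= -ps hx hz.
Qed.

Lemma ambient_w_continuous (z : int) (x : 'I_l -> int) :
  continuous (fun w : Z => (z, (x, w)) : ambient l).
Proof.
move=> w; apply: (@cvg_pair _ int _ (nbhs w) (nbhs z)
  (nbhs ((x, w) : ({ptws 'I_l -> int} * Z)%type))); first exact: cvg_cst.
by apply: (@cvg_pair _ {ptws 'I_l -> int} Z (nbhs w) (nbhs _) (nbhs w));
  [exact: cvg_cst|exact: cvg_id].
Qed.

(** Characters close to $\phi(w)$ come from tuples whose coordinates after the
    first infinite one of [w] are arbitrary, which is why [U] has to be
    saturated. Removing from the domain of [s] the image of the compact set [C]
    of bad tuples does at once what a tube lemma for these coordinates would. *)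
Lemma psi_saturated_nbhs g (U : set (Sigma l)) : open U ->
  (forall h k, sheu_eq h k -> U h -> U k) -> U g ->
  nbhs (psi R g) [set gam | exists2 h, U h & psi R h = gam].
Proof.
move=> [V oV VU] Usat Ug.
set x := am_x (val g); set z := am_z (val g); set s := psi_B R (val g).
pose C : set Z := [set w | nbar w] `&` @Phi R l @^-1` char_dom s `&`
  [set w | ~ V (z, (x, w))].
have Ccompact : compact C.
  rewrite /C -setIA; apply: compact_closedI; first exact: compact_nbar.
  apply: closedI.
    move/continuous_closedP : (@Phi_continuous R l); apply; exact: closed_char.
  have : closed ((fun w : Z => (z, (x, w)) : ambient l) @^-1` (~` V)).
    have /continuous_closedP := @ambient_w_continuous z x.
    by apply; exact: open_closedC.
  by [].
have PC : closed (@Phi R l @` C).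
  apply: compact_closed; first exact: chars_hausdorff.
  apply: continuous_compact => //.
  exact/continuous_subspaceT/Phi_continuous.
pose W : set (chars T) := char_dom s `&` ~` (@Phi R l @` C).
have oW : open W by apply: openI; [exact: open_char|exact: closed_openC].
have sg : char_dom s (Phi R (am_w (val g))) by exact: psi_dom.
have sx : translates s x z by exact: psi_translates.
have inU h : am_x (val h) = x -> am_z (val h) = z ->
    ~ C (am_w (val h)) -> char_dom s (Phi R (am_w (val h))) -> U h.
  move=> hx hz hC hs; rewrite -VU; apply: contrapT => nV; apply: hC.
  split; first by split=> //; exact: Sigma_nbar.
  have E : (z, (x, am_w (val h))) = val h by exact: ambient_ext.
  by change (~ V (z, (x, am_w (val h)))); rewrite E.
have oO : open (theta s W).
  move=> gam tg; exists s, W; split=> // y; by case.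
have gO : theta s W (val (psi R g)).
  suff Wg : W (Phi R (am_w (val g))) by exists (psi_pair R (val g)).
  split=> //; move=> [c [[nc cs] Vc] cg].
  (* c yields an element with the image of g, hence in U, against the choice of C *)
  have cS := domain_Sigma nc cs sx.
  pose c' : Sigma l := exist _ (z, (x, c)) (mem_set cS).
  have : U c'.
    by apply: Usat Ug; apply: psi_sheu_eq; apply/psi_eqP; split.
  by rewrite -VU.
have : nbhs (psi R g) (val @^-1` theta s W).
  apply: (@initial_continuous _ _ (val : Gtight T -> germ T)).
  exact: open_nbhs_nbhs.
apply: filterS => gam [q [gq qs [qd qC]]]; have [h hg] := psi_surj gam.
exists h => //; rewrite -hg in gq; have [qh qx _] := act_psi gq.
rewrite qs in qx; rewrite qh in qd qC.
have [hx hz] := translates_uniq qd qx sx.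
by apply: inU => // hC; apply: qC; exists (am_w (val h)).
Qed.

End Psi.

Theorem proposition6p1 (R : realType) (l : nat) (hl : (1 <= l)%N) :
  continuous (@psi R l) /\
  (forall g h : Sigma l, sheu_eq g h -> psi R g = psi R h) /\
  exists psit : sheu_groupoid l -> tight_groupoid (Tsg R l),
    (forall g : Sigma l, psit (sheu_class g) = psi R g) /\
    is_topGroupoid_iso psit.
Proof.
split; first exact: psi_continuous.
split; first exact: sheu_eq_psi.
pose rep (c : sheu l) : Sigma l := repr (c : {eq_quot sheu_rel l}).
have repK c : sheu_class (rep c) = c by exact: reprK.
pose psit (c : sheu_groupoid l) : tight_groupoid (Tsg R l) := psi R (rep c).
have psitE g : psit (sheu_class g) = psi R g.
  by apply/sheu_eq_psi/sheu_classP; exact: repK.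
(* Products exist in the quotient once the representatives are truncated: then
   equal characters mean equal tuples. *)
have tE g : sheu_class (Sigma_truncate g) = sheu_class g.
  by apply/esym/sheu_classP; exact: sheu_eq_truncate.
have classE g h : psi R g = psi R h -> sheu_class g = sheu_class h.
  by move=> gh; apply/sheu_classP; exact: psi_sheu_eq gh.
exists psit; split=> //; split.
- move=> g h k; rewrite -(repK g) -(repK h) -(repK k) !psitE.
  move: (rep g) (rep h) (rep k) => {}g {}h {}k.
  split=> [[a [b [c [/esym/sheu_classP ga /esym/sheu_classP hb /esym/sheu_classP kc]]]]|].
    rewrite -(sheu_eq_psi R ga) -(sheu_eq_psi R hb) -(sheu_eq_psi R kc).
    move=> [ba cab]; apply/germ_mul_psi; rewrite cab; split=> //.
    by rewrite -ba.
  move=> /germ_mul_psi[hw kw kx kz].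
  exists (Sigma_truncate g), (Sigma_truncate h), (Sigma_truncate k).
  rewrite !tE; split=> //; split.
    rewrite /am_range /am_source /am_w /am_x /= -trunc_translate.
    exact: Phi_inj (@Sigma_nbar _ h) (@Sigma_nbar_source _ g) hw.
  apply: ambient_ext; rewrite /am_z /am_x /am_w //=.
  exact: Phi_inj (@Sigma_nbar _ k) (@Sigma_nbar _ g) kw.
- move=> g h; rewrite -(repK g) -(repK h) !psitE.
  move: (rep g) (rep h) => {}g {}h.
  split=> [[a [b [/esym/sheu_classP ga /esym/sheu_classP hb]]]|].
    rewrite -(sheu_eq_psi R ga) -(sheu_eq_psi R hb).
    by move=> ba; apply/germ_inv_psi; rewrite ba.
  move=> /germ_inv_psi[hw hx hz].
  exists (Sigma_truncate g), (Sigma_truncate h); rewrite !tE; split=> //.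
  apply: ambient_ext => //.
  rewrite /am_source /am_w /am_x /= -trunc_translate.
  exact: Phi_inj (@Sigma_nbar _ h) (@Sigma_nbar_source _ g) hw.
pose f' (gam : tight_groupoid (Tsg R l)) : sheu_groupoid l :=
  sheu_class (sval (cid (psi_surj gam))).
have f'E g : f' (psi R g) = sheu_class g.
  by apply: classE; exact: svalP (cid (psi_surj (psi R g))).
exists f'; split.
- by move=> g; rewrite -(repK g) psitE f'E.
- by move=> gam; have [g <-] := psi_surj gam; rewrite f'E psitE.
- apply/quotient_continuous; rewrite (_ : _ \o _ = @psi R l).
    exact: psi_continuous.
  by apply/funext => g; exact: psitE.
- move=> gam A; have [g <-] := psi_surj gam; rewrite f'E nbhsE => -[B [oB Bg] BA].
  have : nbhs (psi R g) [set gam | exists2 h, (@sheu_class l @^-1` B) h & psi R h = gam].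
    apply: psi_saturated_nbhs => // h k /sheu_classP hk.
    by rewrite /= hk.
  by apply: filterS => _ [h Bh <-]; rewrite /= f'E; exact: BA.
Qed.
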